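(* Let $\mu \in \mathbb{R}\setminus\{0\}$ and let $\Omega$ be a domain in $\mathbb{R}^2$. If $v$ is $\mu$-panharmonic in $\Omega$, then $$a(\mu r)\, v(x) = \frac{1}{\pi r^2} \int_{D_r(x)} v(y) \log \frac{r}{|x-y|}\, dy, \qquad a(t) = \frac{2\,[I_0(t)-1]}{t^2},$$ for every admissible disc $D_r(x)$.
   Context: For $x\in\mathbb{R}^2$ and $r>0$, $D_r(x)=\{y\in\mathbb{R}^2: |y-x|<r\}$ is the open disc of radius $r$ centred at $x$; it is called admissible with respect to a domain $\Omega\subset\mathbb{R}^2$ if $\overline{D_r(x)}\subset\Omega$. A real-valued function $v$ is called $\mu$-panharmonic (or panharmonic) in $\Omega$ if it is a solution in $\Omega$ of the modified Helmholtz equation $\nabla^2 v-\mu^2 v=0$, where $\nabla^2=\partial^2/\partial x_1^2+\partial^2/\partial x_2^2$. $I_0$ denotes the modified Bessel function of the first kind of order $0$. *)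

(* Defs.v *)
(* Built on MathComp-Analysis: points of the plane are pairs in R * R. *)
From mathcomp Require Export all_boot all_order all_algebra.
From mathcomp Require Export all_classical all_reals all_analysis.
Export numFieldNormedType.Exports.
Export Order.TTheory GRing.Theory Num.Theory.

Set Implicit Arguments.
Unset Strict Implicit.
Unset Printing Implicit Defensive.

Local Open Scope classical_set_scope.
Local Open Scope ring_scope.

Section Plane.
Context {R : realType}.
Implicit Types (x y z : R * R) (r t mu : R) (Omega : set (R * R))
  (v : R * R -> R).

(* The library norm on R * R is the sup norm; it induces the Euclidean topology
   (so open, closure, connected and differentiation are the usual notions), but
   discs and distances need the Euclidean norm. *)
Definition enorm z : R := Num.sqrt (z.1 ^+ 2 + z.2 ^+ 2).

Definition disc x r : set (R * R) := [set y | enorm (y - x) < r].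

Definition planar_domain Omega := [/\ Omega !=set0, open Omega & connected Omega].

Definition admissible_disc Omega x r := 0 < r /\ closure (disc x r) `<=` Omega.

Definition partial1 v : R * R -> R := fun x => 'D_((1, 0) : R * R) v x.
Definition partial2 v : R * R -> R := fun x => 'D_((0, 1) : R * R) v x.

Definition laplacian v : R * R -> R :=
  fun x => partial1 (partial1 v) x + partial2 (partial2 v) x.

Definition C1_on Omega v :=
  [/\ forall x, Omega x -> derivable v x ((1, 0) : R * R),
      forall x, Omega x -> derivable v x ((0, 1) : R * R),
      forall x, Omega x -> {for x, continuous (partial1 v)} &
      forall x, Omega x -> {for x, continuous (partial2 v)}].

Definition C2_on Omega v :=
  [/\ C1_on Omega v, C1_on Omega (partial1 v) & C1_on Omega (partial2 v)].

(* Solutions are classical, i.e. of class C^2 in Omega; the values of v outside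
   Omega are irrelevant. *)
Definition panharmonic mu Omega v :=
  C2_on Omega v /\
  forall x, Omega x -> laplacian v x - mu ^+ 2 * v x = 0.

Definition besselI0 t : R :=
  limn (series (fun k => (t / 2) ^+ k.*2 / (k`!%:R ^+ 2))).

Definition a_coef t : R := 2 * (besselI0 t - 1) / t ^+ 2.

End Plane.

(* Main.v *)
Require Import Defs.
From mathcomp Require Import ring lra measurable_realfun.
From mathcomp Require Import lebesgue_integral_under.

(** The idea is to let the disc grow from its centre [x] and to expand the
logarithmic mean over the disc of radius [s] as a Taylor series in [s ^+ 2].
No polar coordinates are used: dilating the disc to the unit disc, all
integrals are over the unit disc and all integrations by parts take place on
its chords, by Fubini and the fundamental theorem of calculus
([integral_disc_deriv1], [integral_disc_deriv2]).

Write [weight k z] for [((1 - |z| ^+ 2) / 2) ^+ k / k!], and let [N k s] be the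
integral over the unit disc of [v (x + s *: z) * weight k z].  The gradient of
[weight k.+1] is [- z * weight k], and [weight k.+1] vanishes on the unit
circle.  Hence the derivative in [s] of [N k], which is the integral of the
gradient of [v] against [z * weight k], becomes [s] times the integral of the
Laplacian of [v] against [weight k.+1], and for a panharmonic function this is
[mu ^+ 2 * s * N k.+1 s] ([is_derive_weighted_mean]).  The same method, applied
to the radial field [z * v (x + s *: z) * ln (1 / |z|)], whose divergence
integrates to zero, shows that if [L s] is the integral of
[v (x + s *: z) * ln (1 / |z|)], then the derivative of [s ^+ 2 * L s] is
[s * N 0 s] ([is_derive_sqr_log_mean]).

So in the sequence [mu ^+ 2 * s ^+ 2 * L s], [N 0 s], [N 1 s], ... each function
has derivative [mu ^+ 2 * s] times the next one.  As all the [N k] are bounded by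
a common constant, the first function is the sum of its Taylor series in
[mu ^+ 2 * s ^+ 2 / 2] ([derivation_chain_series]).  The coefficients are the
values at [s = 0], namely [0] and then [v x] times the moments of the weights;
these moments are [pi / (2 ^+ k * (k.+1)!)] ([momentE]), so the series is
[2 * pi * v x] times that of [I_0 (mu * s) - 1] ([log_mean_bessel]).  Undoing the dilation at [s = r]
([integral_disc_dilation]) gives the formula. *)

Set Implicit Arguments.
Unset Strict Implicit.
Unset Printing Implicit Defensive.

Local Open Scope classical_set_scope.
Local Open Scope ring_scope.

(** * Measurability of open sets and continuous functions on the plane *)

(** An open set is the union of the countably many rational boxes it contains. *)
Lemma open_prod_measurable {R : realType} (U : set (R * R)) :
  open U -> measurable (U : set (measurableTypeR R * measurableTypeR R)).
Proof.
move=> oU.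
pose box (q : rat * rat * rat) : set (R * R) :=
  ball (ratr q.1.1 : R) (ratr q.2 : R) `*` ball (ratr q.1.2 : R) (ratr q.2 : R).
have -> : U = \bigcup_(q in [set q | box q `<=` U]) box q.
  apply/seteqP; split => [[a b] Uab|[a b] [q /= qU] /qU //].
  have /nbhs_ballP[e /= e0 eU] : nbhs (a, b) U by exact: open_nbhs_nbhs.
  have e20 : 0 < e / 2 by rewrite divr_gt0.
  have [q q0 qe] : exists2 q : rat, 0 < (ratr q : R) & (ratr q : R) < e / 2.
    have [q] := rat_in_itvoo e20.
    by rewrite in_itv/= => /andP[? ?]; exists q.
  have near_rat (c : R) : exists p : rat, `|c - ratr p| < ratr q.
    have [p] : exists p : rat, (ratr p : R) \in `](c - ratr q), (c + ratr q)[.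
      by apply: rat_in_itvoo; rewrite ltrBlDr -addrA ltrDl addr_gt0.
    rewrite in_itv/= => /andP[p1 p2]; exists p.
    by rewrite ltr_norml; apply/andP; split; lra.
  have [p ap] := near_rat a; have [p' bp'] := near_rat b.
  exists (p, p', q); last by rewrite /box /=; split; rewrite /ball/= distrC.
  move=> [c d] [/= cp dp]; apply: eU; split => /=.
    rewrite /ball /=; apply: (le_lt_trans (ler_distD (ratr p) _ _)).
    by rewrite [ltRHS]splitr ltrD // (lt_trans _ qe).
  rewrite /ball /=; apply: (le_lt_trans (ler_distD (ratr p') _ _)).
  by rewrite [ltRHS]splitr ltrD // (lt_trans _ qe).
rewrite bigcup_mkcond; apply: countable_bigcupT_measurable => // q.
case: ifP => // _.
by apply: measurableX; apply: open_measurable; exact: ball_open.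
Qed.

Lemma continuous_on_measurable {R : realType} (U : set (R * R)) (f : R * R -> R) :
  open U -> (forall z, U z -> {for z, continuous f}) ->
  measurable_fun (U : set (measurableTypeR R * measurableTypeR R)) f.
Proof.
move=> oU cf; apply: (measurability _ (RGenOpens.measurableE R)).
move=> _ [_ [a [b ->] <-]]; apply: open_prod_measurable.
rewrite openE => z [Uz fz]; rewrite /interior.
apply: filterI; first exact: open_nbhs_nbhs.
by apply: cf => //; apply: open_nbhs_nbhs; split => //; exact: interval_open.
Qed.

(** * The unit disc, its chords and its area *)

Notation leb2 R := (@lebesgue_measure R \x @lebesgue_measure R)%E.

Definition unit_disc {R : realType} : set (R * R) :=
  [set z | z.1 ^+ 2 + z.2 ^+ 2 < 1].

Section chords.
Context {R : realType}.
Notation D := (@unit_disc R).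
Notation mu := (@lebesgue_measure R).

Lemma continuous_pairl (b : R) : continuous (fun t : R => (t, b)).
Proof.
move=> t A [[P Q] [/= tP bQ] PQA]; apply: filterS tP => u Pu.
by apply: PQA; split => //=; exact: nbhs_singleton.
Qed.

Lemma continuous_pairr (a : R) : continuous (fun t : R => (a, t)).
Proof.
move=> t A [[P Q] [/= aP tQ] PQA]; apply: filterS tQ => u Qu.
by apply: PQA; split => //=; exact: nbhs_singleton.
Qed.

Lemma continuous_slice1 (g : R * R -> R) (a b : R) :
  {for (a, b), continuous g} -> {for a, continuous (fun t => g (t, b))}.
Proof.
move=> cg; apply: (@continuous_comp _ _ _ (fun t : R => (t, b))) => //.
exact: continuous_pairl.
Qed.

Lemma continuous_slice2 (g : R * R -> R) (a b : R) :
  {for (a, b), continuous g} -> {for b, continuous (fun t => g (a, t))}.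
Proof.
move=> cg; apply: (@continuous_comp _ _ _ (fun t : R => (a, t))) => //.
exact: continuous_pairr.
Qed.

Lemma continuous_sqr1 : continuous (fun z : R * R => z.1 ^+ 2).
Proof.
move=> z; apply: (@continuous_comp _ _ _ fst (fun a : R => a ^+ 2)).
  exact: cvg_fst.
exact: exprn_continuous.
Qed.

Lemma continuous_sqr2 : continuous (fun z : R * R => z.2 ^+ 2).
Proof.
move=> z; apply: (@continuous_comp _ _ _ snd (fun a : R => a ^+ 2)).
  exact: cvg_snd.
exact: exprn_continuous.
Qed.

Lemma continuous_sqnorm : continuous (fun z : R * R => z.1 ^+ 2 + z.2 ^+ 2).
Proof.
by move=> z; apply: cvgD; [exact: continuous_sqr1|exact: continuous_sqr2].
Qed.

Lemma sqnorm_gt0_snd (a b : R) : b != 0 -> 0 < a ^+ 2 + b ^+ 2.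
Proof. by move=> b0; rewrite ltr_wpDl ?sqr_ge0 // exprn_even_gt0. Qed.

Lemma sqnorm_gt0_fst (a b : R) : a != 0 -> 0 < a ^+ 2 + b ^+ 2.
Proof. by move=> a0; rewrite ltr_wpDr ?sqr_ge0 // exprn_even_gt0. Qed.

Lemma open_unit_disc : open D.
Proof.
rewrite (_ : D = (fun z : R * R => z.1 ^+ 2 + z.2 ^+ 2) @^-1` `]-oo, 1[%classic).
  apply: open_comp; last exact: interval_open.
  by move=> z _; exact: continuous_sqnorm.
by apply/seteqP; split => z; rewrite /= in_itv.
Qed.

Lemma measurable_unit_disc :
  measurable (D : set (measurableTypeR R * measurableTypeR R)).
Proof. by apply: open_prod_measurable; exact: open_unit_disc. Qed.

Lemma lt_sqr_chord (a b : R) :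
  (a ^+ 2 + b ^+ 2 < 1) = (a \in `](- Num.sqrt (1 - b ^+ 2)), (Num.sqrt (1 - b ^+ 2))[).
Proof.
rewrite in_itv/= -ltr_norml -sqrtr_sqr.
have [b1|b1] := ltP 0 (1 - b ^+ 2).
  by rewrite ltr_sqrt// ltrBrDr.
rewrite [Num.sqrt (1 - _)]ler0_sqrtr // (ltNge (Num.sqrt _)) sqrtr_ge0.
by apply/negbTE; rewrite -leNgt; have := sqr_ge0 a; lra.
Qed.

Lemma section1_unit_disc (f : R * R -> \bar R) (b : R) :
  (\int[mu]_a (f \_ D) (a, b) =
   \int[mu]_(a in `](- Num.sqrt (1 - b ^+ 2))%R, (Num.sqrt (1 - b ^+ 2))%R[) f (a, b))%E.
Proof.
rewrite [RHS]integral_mkcond; apply: eq_integral => a _.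
by rewrite !patchE !mem_setE /= -lt_sqr_chord.
Qed.

Lemma section2_unit_disc (f : R * R -> \bar R) (a : R) :
  (\int[mu]_b (f \_ D) (a, b) =
   \int[mu]_(b in `](- Num.sqrt (1 - a ^+ 2))%R, (Num.sqrt (1 - a ^+ 2))%R[) f (a, b))%E.
Proof.
rewrite [RHS]integral_mkcond; apply: eq_integral => b _.
by rewrite !patchE !mem_setE /= -lt_sqr_chord addrC.
Qed.

Lemma integral_derivative_chord (F g : R -> R) (h : R) : 0 <= h ->
  (forall t, -h <= t <= h -> is_derive t 1 F (g t)) ->
  (forall t, -h <= t <= h -> {for t, continuous g}) ->
  (\int[mu]_(t in `](- h)%R, h[) (g t)%:E = (F h - F (- h))%:E)%E.
Proof.
rewrite le_eqVlt => /predU1P[<- _ _|h0 dF cg].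
  by rewrite oppr0 subrr set_itvoo0 integral_set0.
have cg' : {within `[(- h), h], continuous g}.
  by apply: continuous_in_subspaceT => t; rewrite inE /= in_itv /=; exact: cg.
rewrite -(@integral_itv_bndoo _ _ _ _ true false); last first.
  apply/measurable_EFinP; apply: (@measurable_funS _ _ _ _ `[(- h), h]) => //.
    by apply: subset_itvW.
  by apply: subspace_continuous_measurable_fun.
have cF t : -h <= t <= h -> F @ t --> F t.
  by move=> /dF dt; apply/differentiable_continuous/derivable1_diffP.
rewrite (@continuous_FTC2 _ g F) //.
- by lra.
- split.
  + by move=> t; rewrite in_itv/= => /andP[? ?]; have [] : is_derive t 1 F (g t) by apply: dF; lra.
  + by apply: cvg_at_right_filter; apply: cF; lra.
  + by apply: cvg_at_left_filter; apply: cF; lra.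
- move=> t; rewrite in_itv/= => /andP[? ?]; rewrite derive1E.
  by have [] : is_derive t 1 F (g t) by apply: dF; lra.
Qed.

Lemma ae_neq0 : {ae mu, forall b : measurableTypeR R, b != 0 :> R}.
Proof.
exists [set 0]; split => //; first exact: lebesgue_measure_set1.
by move=> b /= /negP; rewrite negbK => /eqP.
Qed.

(** The divergence theorem for a field with one component, vanishing on the unit
circle: each chord contributes zero.  The chord through the origin is left out,
being negligible, so that the field may be singular at the origin. *)
Lemma integral_disc_deriv1 (F g : R * R -> R) :
  (leb2 R).-integrable D (EFin \o g) ->
  (forall a b : R, b != 0 -> a ^+ 2 + b ^+ 2 <= 1 ->
     is_derive a 1 (fun t => F (t, b)) (g (a, b))) ->
  (forall a b : R, b != 0 -> a ^+ 2 + b ^+ 2 <= 1 ->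
     {for a, continuous (fun t => g (t, b))}) ->
  (forall a b : R, b != 0 -> a ^+ 2 + b ^+ 2 = 1 -> F (a, b) = 0) ->
  \int[leb2 R]_(z in D) g z = 0.
Proof.
move=> ig dF cg F0.
have ig' : (leb2 R).-integrable setT ((EFin \o g) \_ D).
  by apply/(integrable_mkcond _ measurable_unit_disc).1.
rewrite /Rintegral integral_mkcond -integral21_prod_meas1 //.
rewrite (_ : \int[_]_y _ = 0)%E//.
rewrite (@ae_eq_integral _ _ _ _ _ (cst 0%E)) //.
- by rewrite integral0_eq.
- exact: (measurable_fubini_G ig').
apply: filterS ae_neq0 => b b0 _; rewrite /fubini_G section1_unit_disc /=.
have [b1|b1] := leP (b ^+ 2) 1; last first.
  by rewrite ler0_sqrtr ?oppr0 ?set_itvoo0 ?integral_set0 //; lra.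
have in_chord t : - Num.sqrt (1 - b ^+ 2) <= t <= Num.sqrt (1 - b ^+ 2) ->
    t ^+ 2 + b ^+ 2 <= 1.
  by rewrite -ler_norml -sqrtr_sqr ler_sqrt ?subr_ge0 // lerBrDr.
apply: etrans.
  apply: (@integral_derivative_chord (fun t => F (t, b))); first exact: sqrtr_ge0.
    by move=> t /in_chord; exact: dF.
  by move=> t /in_chord; exact: cg.
by rewrite /= !F0 ?subrr // ?sqrrN sqr_sqrtr ?subr_ge0 // subrK.
Qed.

Lemma integral_disc_deriv2 (F g : R * R -> R) :
  (leb2 R).-integrable D (EFin \o g) ->
  (forall a b : R, a != 0 -> a ^+ 2 + b ^+ 2 <= 1 ->
     is_derive b 1 (fun t => F (a, t)) (g (a, b))) ->
  (forall a b : R, a != 0 -> a ^+ 2 + b ^+ 2 <= 1 ->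
     {for b, continuous (fun t => g (a, t))}) ->
  (forall a b : R, a != 0 -> a ^+ 2 + b ^+ 2 = 1 -> F (a, b) = 0) ->
  \int[leb2 R]_(z in D) g z = 0.
Proof.
move=> ig dF cg F0.
have ig' : (leb2 R).-integrable setT ((EFin \o g) \_ D).
  by apply/(integrable_mkcond _ measurable_unit_disc).1.
rewrite /Rintegral integral_mkcond -integral12_prod_meas1 //.
rewrite (_ : \int[_]_y _ = 0)%E//.
rewrite (@ae_eq_integral _ _ _ _ _ (cst 0%E)) //.
- by rewrite integral0_eq.
- exact: (measurable_fubini_F ig').
apply: filterS ae_neq0 => a a0 _; rewrite /fubini_F section2_unit_disc /=.
have [a1|a1] := leP (a ^+ 2) 1; last first.
  by rewrite ler0_sqrtr ?oppr0 ?set_itvoo0 ?integral_set0 //; lra.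
have in_chord t : - Num.sqrt (1 - a ^+ 2) <= t <= Num.sqrt (1 - a ^+ 2) ->
    a ^+ 2 + t ^+ 2 <= 1.
  by rewrite -ler_norml -sqrtr_sqr ler_sqrt ?subr_ge0 // lerBrDl.
apply: etrans.
  apply: (@integral_derivative_chord (fun t => F (a, t))); first exact: sqrtr_ge0.
    by move=> t /in_chord; exact: dF.
  by move=> t /in_chord; exact: cg.
by rewrite /= !F0 ?subrr // ?sqrrN sqr_sqrtr ?subr_ge0 // subrKC.
Qed.

End chords.

Section area.
Context {R : realType}.
Notation D := (@unit_disc R).
Notation mu := (@lebesgue_measure R).

Lemma integral_sqrt_chord :
  (\int[mu]_(t in `[(- 1)%R, 1%R]) (Num.sqrt (1 - t ^+ 2) *+ 2)%:E = pi%:E)%E.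
Proof.
have p0 := @pi_gt0 R.
have -> : `[(- 1)%R, 1%R]%classic = `[sin (- (pi / 2) : R), sin (pi / 2)]%classic.
  by rewrite sinN sin_pihalf.
rewrite (@integration_by_substitution_increasing _ sin) //.
- transitivity (\int[mu]_(t in `[(- (pi / 2))%R, (pi / 2)%R]) (cos t ^+ 2 *+ 2)%:E)%E.
    apply: eq_integral => t; rewrite inE /= in_itv /= => tp; congr EFin.
    have -> : (@sin R)^`()%classic = @cos R by apply/funext => u; rewrite derive1E derive_val.
    rewrite /GRing.mul /= -cos2sin2 sqrtr_sqr ger0_norm ?cos_ge0_pihalf //.
    by rewrite mulrnAl -expr2.
  rewrite (@continuous_FTC2 _ _ (fun t => t + cos t * sin t)) //.
  + rewrite cosN cos_pihalf !mul0r !addr0 -EFinB; congr EFin.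
    by field.
  + by lra.
  + apply: continuous_subspaceT => t.
    under eq_fun do rewrite mulr2n expr2.
    by apply: cvgD; apply: cvgM; exact: continuous_cos.
  + split.
    * by move=> t _.
    * apply: cvg_at_right_filter; apply: cvgD; first exact: cvg_id.
      by apply: cvgM; [exact: continuous_cos|exact: continuous_sin].
    * apply: cvg_at_left_filter; apply: cvgD; first exact: cvg_id.
      by apply: cvgM; [exact: continuous_cos|exact: continuous_sin].
  + move=> t _; rewrite derive1E derive_val /=.
    have := cos2Dsin2 t; rewrite /GRing.scale /= => c2.
    rewrite !expr2 in c2 *; lra.
- by lra.
- by move=> x y xpi ypi; rewrite ltr_sin.
- have -> : (@sin R)^`()%classic = @cos R by apply/funext => u; rewrite derive1E derive_val.
  by move=> t _; exact: continuous_cos.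
- have -> : (@sin R)^`()%classic = @cos R by apply/funext => u; rewrite derive1E derive_val.
  by apply/cvg_ex; eexists; apply: cvg_at_right_filter; exact: continuous_cos.
- have -> : (@sin R)^`()%classic = @cos R by apply/funext => u; rewrite derive1E derive_val.
  by apply/cvg_ex; eexists; apply: cvg_at_left_filter; exact: continuous_cos.
- split.
  + by move=> t _.
  + by apply: cvg_at_right_filter; exact: continuous_sin.
  + by apply: cvg_at_left_filter; exact: continuous_sin.
- apply: continuous_subspaceT => t.
  have c t' : {for t', continuous (fun u : R => Num.sqrt (1 - u ^+ 2))}.
    apply: (@continuous_comp _ _ _ (fun u : R => 1 - u ^+ 2) Num.sqrt).
      by apply: cvgB; [exact: cvg_cst|exact: exprn_continuous].
    exact: sqrt_continuous.
  by under eq_fun do rewrite mulr2n; apply: cvgD; exact: c.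
Qed.

Lemma area_unit_disc : leb2 R D = pi%:E.
Proof.
rewrite -[LHS]mul1e -(integral_cst (leb2 R) measurable_unit_disc 1%E).
rewrite integral_mkcond fubini_tonelli2; last 2 first.
- exact: (measurable_restrictT (cst 1%E) measurable_unit_disc).1 (measurable_cst _).
- by move=> z; rewrite patchE; case: ifP.
rewrite -integral_sqrt_chord [RHS]integral_mkcond; apply: eq_integral => b _.
rewrite /fubini_G section1_unit_disc patchE mem_setE in_itv /=.
rewrite integral_cst//= mul1e lebesgue_measure_itv /= lte_fin.
have -> : (-1 <= b <= 1) = (b ^+ 2 <= 1).
  rewrite -ler_norml; apply/idP/idP => h.
    by have := real_normK (num_real b); have := normr_ge0 b; nra.
  by have := real_normK (num_real b); have := normr_ge0 b; nra.
have [b1|b1] := leP (b ^+ 2) 1.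
  have := sqrtr_ge0 (1 - b ^+ 2); rewrite le_eqVlt => /predU1P[<-|h0].
    by rewrite oppr0 ltxx mul0rn.
  by rewrite ifT ?opprK -?EFinD ?mulr2n ?opprK //; lra.
by rewrite ler0_sqrtr ?oppr0 ?ltxx//; lra.
Qed.

Lemma integrable_disc_bounded (f : R * R -> R) (M : R) :
  measurable_fun (D : set (measurableTypeR R * measurableTypeR R)) f ->
  (forall z, D z -> `|f z| <= M) -> (leb2 R).-integrable D (EFin \o f).
Proof.
move=> mf fM; apply: measurable_bounded_integrable => //.
- exact: measurable_unit_disc.
- by apply: (@le_lt_trans _ _ pi%:E); [rewrite -area_unit_disc|exact: ltry].
- by exists M; split; rewrite ?num_real // => N MN z /fM; move=> /le_trans; apply; exact: ltW.
Qed.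

End area.

(** * Radial weights and their moments *)

(** The factorial and the powers of [2] are chosen so that the gradient of
[weight k.+1] is exactly [- z * weight k]. *)
Definition weight {R : realType} (k : nat) (z : R * R) : R :=
  ((1 - (z.1 ^+ 2 + z.2 ^+ 2)) / 2) ^+ k / k`!%:R.

Section weights.
Context {R : realType}.
Notation D := (@unit_disc R).

Lemma compact_closed_unit_disc :
  compact [set z : R * R | z.1 ^+ 2 + z.2 ^+ 2 <= 1].
Proof.
apply: (@subclosed_compact _ _ (`[(-1 : R), 1]%classic `*` `[(-1 : R), 1]%classic)).
- rewrite (_ : mkset _ = (fun z : R * R => z.1 ^+ 2 + z.2 ^+ 2) @^-1` `]-oo, 1]%classic).
    by apply: closed_comp => [z _|]; [exact: continuous_sqnorm|exact: interval_closed].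
  by apply/seteqP; split => z; rewrite /= in_itv.
- by apply: compact_setX; exact: segment_compact.
- by move=> [a b] /= ab; split; rewrite /= in_itv /=; apply/andP; split; nra.
Qed.

Lemma integrable_disc_continuous (f : R * R -> R) :
  (forall z, z.1 ^+ 2 + z.2 ^+ 2 <= 1 -> {for z, continuous f}) ->
  (leb2 R).-integrable D (EFin \o f).
Proof.
move=> cf.
have [M [_ fM]] : bounded_set (f @` [set z : R * R | z.1 ^+ 2 + z.2 ^+ 2 <= 1]).
  apply: compact_bounded; apply: continuous_compact compact_closed_unit_disc.
  by apply: continuous_in_subspaceT => z; rewrite inE; exact: cf.
apply: (@integrable_disc_bounded _ _ (M + 1)).
  by apply: continuous_on_measurable => [|z /ltW]; [exact: open_unit_disc|exact: cf].
by move=> z /ltW zD; apply: (fM (M + 1)); [rewrite ltrDl|exists z].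
Qed.

Lemma continuous_weight k : continuous (@weight R k).
Proof.
move=> z; apply: cvgM; last exact: cvg_cst.
pose q (w : R * R) : R := (1 - (w.1 ^+ 2 + w.2 ^+ 2)) / 2.
apply: (@continuous_comp _ _ _ q (fun a : R => a ^+ k)); last first.
  exact: exprn_continuous.
apply: cvgM; last exact: cvg_cst.
by apply: cvgB; [exact: cvg_cst|exact: continuous_sqnorm].
Qed.

Lemma weight_ge0 k (z : R * R) : D z -> 0 <= weight k z.
Proof. by rewrite /unit_disc /= => zD; rewrite divr_ge0 // exprn_ge0 //; lra. Qed.

Lemma weight_le1 k (z : R * R) : D z -> weight k z <= 1.
Proof.
rewrite /unit_disc /= => zD; rewrite /weight ler_pdivrMr ?ltr0n ?fact_gt0 // mul1r.
apply: (@le_trans _ _ 1); last by rewrite ler1n fact_gt0.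
have := sqr_ge0 z.1; have := sqr_ge0 z.2.
by move=> ? ?; apply: exprn_ile1; lra.
Qed.

Lemma weight_sphere k (z : R * R) : z.1 ^+ 2 + z.2 ^+ 2 = 1 -> weight k.+1 z = 0.
Proof. by rewrite /weight => ->; rewrite subrr !mul0r expr0n mul0r. Qed.

(** With [u = (1 - |z| ^+ 2) / 2] one has [|z| ^+ 2 = 1 - 2 * u], while
multiplying by [u] turns [weight k] into [k.+1] times [weight k.+1]. *)
Lemma weightS k (z : R * R) :
  (z.1 ^+ 2 + z.2 ^+ 2) * weight k z = weight k z - k.+1%:R *+ 2 * weight k.+1 z.
Proof.
rewrite /weight (exprS _ k) factS natrM.
have : k`!%:R != 0 :> R by rewrite pnatr_eq0 -lt0n fact_gt0.
have : k.+1%:R != 0 :> R by rewrite pnatr_eq0.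
move: (_ ^+ k) => w k0 k1; field.
by rewrite k1 nat1r k0.
Qed.

Lemma is_derive_weight1 k (a b : R) :
  is_derive a 1 (fun t => weight k.+1 (t, b)) (- a * weight k (a, b)).
Proof.
pose q t : R := (1 - (t ^+ 2 + b ^+ 2)) / 2.
have dq : is_derive a 1 q (- a).
  by apply: is_derive_eq; rewrite /GRing.scale /=; field.
rewrite (_ : (fun t => _) = (k.+1)`!%:R^-1 \*: (q ^+ k.+1)); last first.
  by apply/funext => t; rewrite /weight /= mulrC !fctE.
apply: is_derive_eq; rewrite /weight -/(q a) /GRing.scale /= factS natrM.
have : k`!%:R != 0 :> R by rewrite pnatr_eq0 -lt0n fact_gt0.
have : k.+1%:R != 0 :> R by rewrite pnatr_eq0.
move: (q a ^+ k) => w k0 k1; field.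
by rewrite k1 nat1r k0.
Qed.

Lemma is_derive_weight2 k (a b : R) :
  is_derive b 1 (fun t => weight k.+1 (a, t)) (- b * weight k (a, b)).
Proof.
have sym j u w : @weight R j (u, w) = weight j (w, u) by rewrite /weight /= (addrC (u ^+ 2)).
have -> : (fun t => weight k.+1 (a, t)) = (fun t : R => weight k.+1 (t, a)).
  by apply/funext => t; rewrite sym.
by rewrite sym; exact: is_derive_weight1.
Qed.


Definition moment k := \int[leb2 R]_(z in D) weight k z.

Lemma integrable_weight k : (leb2 R).-integrable D (EFin \o weight k).
Proof. by apply: integrable_disc_continuous => z _; exact: continuous_weight. Qed.

(** The divergence of [z * weight k.+1], which integrates to zero, is
[2 * weight k.+1 - |z| ^+ 2 * weight k], and [weightS] eliminates the factor
[|z| ^+ 2]. *)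
Lemma momentS k : k.+2%:R *+ 2 * moment k.+1 = moment k.
Proof.
pose g1 (z : R * R) := weight k.+1 z - z.1 ^+ 2 * weight k z.
pose g2 (z : R * R) := weight k.+1 z - z.2 ^+ 2 * weight k z.
have cg1 : continuous g1.
  move=> z; apply: cvgB; first exact: continuous_weight.
  apply: cvgM; last exact: continuous_weight.
  exact: continuous_sqr1.
have cg2 : continuous g2.
  move=> z; apply: cvgB; first exact: continuous_weight.
  apply: cvgM; last exact: continuous_weight.
  exact: continuous_sqr2.
have ig1 := integrable_disc_continuous (fun z _ => cg1 z).
have ig2 := integrable_disc_continuous (fun z _ => cg2 z).
have g10 : \int[leb2 R]_(z in D) g1 z = 0.
  apply: (@integral_disc_deriv1 _ (fun z => z.1 * weight k.+1 z)) => //.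
  - move=> a b _ _ /=.
    have := is_derive_weight1 k a b => dw.
    apply: (is_derive_eq (is_deriveM (is_derive_id a 1) dw)).
    by rewrite /g1 /GRing.scale /= expr2; ring.
  - by move=> a b _ _; apply: continuous_slice1; exact: cg1.
  - by move=> a b _ /(@weight_sphere k (a, b)) ->; rewrite mulr0.
have g20 : \int[leb2 R]_(z in D) g2 z = 0.
  apply: (@integral_disc_deriv2 _ (fun z => z.2 * weight k.+1 z)) => //.
  - move=> a b _ _ /=.
    have := is_derive_weight2 k a b => dw.
    apply: (is_derive_eq (is_deriveM (is_derive_id b 1) dw)).
    by rewrite /g2 /GRing.scale /= expr2; ring.
  - by move=> a b _ _; apply: continuous_slice2; exact: cg2.
  - by move=> a b _ /(@weight_sphere k (a, b)) ->; rewrite mulr0.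
have mD := @measurable_unit_disc R.
have := RintegralD mD ig1 ig2; rewrite g10 g20 addr0.
have -> : \int[leb2 R]_(z in D) (g1 z + g2 z) =
    \int[leb2 R]_(z in D) (k.+2%:R *+ 2 * weight k.+1 z - weight k z).
  apply: eq_Rintegral => z _; rewrite /g1 /g2.
  transitivity (weight k.+1 z *+ 2 - (z.1 ^+ 2 + z.2 ^+ 2) * weight k z); first by ring.
  by rewrite weightS; ring.
rewrite RintegralB ?RintegralZl //; first by move/eqP; rewrite subr_eq0 => /eqP.
- exact: integrable_weight.
- apply: integrable_disc_continuous => z _.
  by apply: cvgM; [exact: cvg_cst|exact: continuous_weight].
- exact: integrable_weight.
Qed.

Lemma momentE k : moment k = pi / (2 ^+ k * (k.+1)`!%:R).
Proof.
elim: k => [|k IH].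
  rewrite expr0 mul1r divr1 /moment.
  transitivity (\int[leb2 R]_(z in D) 1).
    by apply: eq_Rintegral => z _; rewrite /weight expr0 fact0 divr1.
  rewrite /Rintegral (@integral_cst _ _ _ (leb2 R) D measurable_unit_disc 1%E) mul1e.
  by rewrite -[RHS]/(fine pi%:E) -area_unit_disc.
have := momentS k; rewrite IH (exprS _ k) (factS k.+1) natrM => h.
have n0 : k.+2%:R *+ 2 != 0 :> R by rewrite mulrn_eq0 pnatr_eq0.
apply: (mulfI n0); rewrite h.
have : (k.+1)`!%:R != 0 :> R by rewrite pnatr_eq0 -lt0n fact_gt0.
have : k.+2%:R != 0 :> R by rewrite pnatr_eq0.
have : 2 ^+ k != 0 :> R by rewrite expf_neq0.
move: (k.+2%:R : R) ((k.+1)`!%:R : R) (2 ^+ k : R) => u w x u0 w0 x0; field.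
by rewrite u0 w0 x0.
Qed.

End weights.

(** * Functions with continuous partial derivatives *)

Section C1_functions.
Context {R : realType}.
Variables (Omega : set (R * R)) (f : R * R -> R).
Hypothesis C1f : C1_on Omega f.

Lemma is_derive_slice1 (a b : R) : Omega (a, b) ->
  is_derive a 1 (fun t => f (t, b)) (partial1 f (a, b)).
Proof.
move=> ab; have [d1 _ _ _] := C1f.
have E : (fun h : R => h^-1 *: (((fun t : R => f (t, b)) \o shift a) (h *: 1) - f (a, b))) =
         (fun h : R => h^-1 *: ((f \o shift (a, b)) (h *: ((1, 0) : R * R)) - f (a, b))).
  apply/funext => h; rewrite /= /GRing.scale /=; congr (_ * (f _ - _)).
  by congr pair; rewrite /= /GRing.scale /= ?mulr0 ?add0r.
by apply: DeriveDef; [rewrite /derivable E; exact: d1|rewrite /derive E].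
Qed.

Lemma is_derive_slice2 (a b : R) : Omega (a, b) ->
  is_derive b 1 (fun t => f (a, t)) (partial2 f (a, b)).
Proof.
move=> ab; have [_ d2 _ _] := C1f.
have E : (fun h : R => h^-1 *: (((fun t : R => f (a, t)) \o shift b) (h *: 1) - f (a, b))) =
         (fun h : R => h^-1 *: ((f \o shift (a, b)) (h *: ((0, 1) : R * R)) - f (a, b))).
  apply/funext => h; rewrite /= /GRing.scale /=; congr (_ * (f _ - _)).
  by congr pair; rewrite /= /GRing.scale /= ?mulr0 ?add0r.
by apply: DeriveDef; [rewrite /derivable E; exact: d2|rewrite /derive E].
Qed.

Let increment (g dg : R -> R) (c d e k : R) : 0 <= d ->
  (forall t, `|c - t| < d -> is_derive t 1 g (dg t) /\ `|dg t - k| <= e) ->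
  forall s t, `|c - s| < d -> `|c - t| < d ->
  `|g s - g t - (s - t) * k| <= e * `|s - t|.
Proof.
move=> d0 H.
have le_case s t : s <= t -> `|c - s| < d -> `|c - t| < d ->
    `|g t - g s - (t - s) * k| <= e * `|t - s|.
  move=> st cs ct.
  have between u : u \in `[s, t] -> `|c - u| < d.
    by move: cs ct; rewrite in_itv /= !ltr_norml => ? ?; lra.
  have [u ust ->] : exists2 u, u \in `[s, t] & g t - g s = dg u * (t - s).
    apply: MVT_segment => // [u ust|].
      by apply: (H u _).1; apply: between; exact: subset_itv_oo_cc ust.
    apply: continuous_in_subspaceT => u; rewrite inE /= => ust.
    apply/differentiable_continuous/derivable1_diffP.
    by have [+ _] := H u (between _ ust); case.
  rewrite (mulrC (t - s)) -mulrBl normrM ler_wpM2r //.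
  by have [] := H u (between _ ust).
move=> s t cs ct; have [st|/ltW ts] := leP s t; last exact: le_case.
rewrite -normrN.
have -> : - (g s - g t - (s - t) * k) = g t - g s - (t - s) * k by ring.
by rewrite (distrC s); exact: le_case.
Qed.

(** Going from [p] to [q] parallel to the axes, each of the two increments is
governed by one partial derivative, and continuity keeps that derivative close
to its value at [p]. *)
Lemma C1_expansion (p : R * R) : open Omega -> Omega p -> forall e, 0 < e ->
  \forall q \near p, `|f q - f p - ((q.1 - p.1) * partial1 f p + (q.2 - p.2) * partial2 f p)|
    <= e * (`|q.1 - p.1| + `|q.2 - p.2|).
Proof.
move=> oO Op e e0; have [_ _ c1 c2] := C1f.
have : \forall q \near p, [/\ Omega q, `|partial1 f p - partial1 f q| <= e
                                     & `|partial2 f p - partial2 f q| <= e].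
  have := c1 _ Op; have := c2 _ Op => /cvgrPdist_le/(_ _ e0) h2 /cvgrPdist_le/(_ _ e0) h1.
  have hO : nbhs p Omega by exact: open_nbhs_nbhs.
  by apply: filterS3 hO h1 h2 => q ? ? ?; split.
move=> /nbhs_ballP[d /= d0 dO].
apply/nbhs_ballP; exists d => //= q [q1 q2].
case: p q Op dO q1 q2 => p1 p2 [q1 q2] Op dO /= pq1 pq2.
rewrite /ball /= in pq1 pq2.
have box a b : `|p1 - a| < d -> `|p2 - b| < d -> [/\ Omega (a, b),
    `|partial1 f (p1, p2) - partial1 f (a, b)| <= e
  & `|partial2 f (p1, p2) - partial2 f (a, b)| <= e].
  by move=> ? ?; apply: dO; split.
have H1 : `|f (q1, q2) - f (p1, q2) - (q1 - p1) * partial1 f (p1, p2)| <= e * `|q1 - p1|.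
  apply: (@increment (fun t => f (t, q2)) (fun t => partial1 f (t, q2)) p1 d) => //.
  - exact: ltW.
  - move=> t pt; have [Ot h _] := box _ _ pt pq2; split; last by rewrite distrC.
    exact: is_derive_slice1.
  - by rewrite subrr normr0.
have H2 : `|f (p1, q2) - f (p1, p2) - (q2 - p2) * partial2 f (p1, p2)| <= e * `|q2 - p2|.
  have pp : `|p1 - p1| < d by rewrite subrr normr0.
  apply: (@increment (fun t => f (p1, t)) (fun t => partial2 f (p1, t)) p2 d) => //.
  - exact: ltW.
  - move=> t pt; have [Ot _ h] := box _ _ pp pt; split; last by rewrite distrC.
    exact: is_derive_slice2.
  - by rewrite subrr normr0.
rewrite mulrDr (le_trans _ (lerD H1 H2)) // (le_trans _ (ler_normD _ _)) //.
by rewrite le_eqVlt; apply/orP; left; apply/eqP; congr (`| _ |); ring.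
Unshelve. all: by end_near. Qed.

Lemma C1_continuous :
  open Omega -> forall p, Omega p -> {for p, continuous f}.
Proof.
move=> oO p Op; apply/cvgrPdist_le => e e0.
pose L := `|partial1 f p| + `|partial2 f p| + 2.
have L0 : 0 < L by rewrite /L ltr_wpDl // addr_ge0.
have near_p : \forall q \near p, `|q.1 - p.1| <= e / L /\ `|q.2 - p.2| <= e / L.
  apply/nbhs_ballP; exists (e / L); first by rewrite /= divr_gt0.
  by move=> q [/ltW + /ltW]; rewrite !(distrC p.1) !(distrC p.2).
near=> q.
have [q1 q2] : `|q.1 - p.1| <= e / L /\ `|q.2 - p.2| <= e / L by near: q.
have H : `|f q - f p - ((q.1 - p.1) * partial1 f p + (q.2 - p.2) * partial2 f p)|
    <= 1 * (`|q.1 - p.1| + `|q.2 - p.2|) by near: q; exact: C1_expansion.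
rewrite mul1r in H.
rewrite distrC.
have -> : f q - f p = (f q - f p - ((q.1 - p.1) * partial1 f p + (q.2 - p.2) * partial2 f p)) +
   ((q.1 - p.1) * partial1 f p + (q.2 - p.2) * partial2 f p) by ring.
rewrite (le_trans (ler_normD _ _)) // (le_trans (lerD H (ler_normD _ _))) // !normrM.
have -> : e = e / L * L by rewrite divfK ?gt_eqF.
move: q1 q2; set u := `|q.1 - p.1|; set w := `|q.2 - p.2|; set c := e / L => u1 w1.
have A1 := ler_wpM2r (normr_ge0 (partial1 f p)) u1.
have A2 := ler_wpM2r (normr_ge0 (partial2 f p)) w1.
by rewrite /L !mulrDr; move: A1 A2 u1 w1; clear; move: (_ * _) (_ * _) (_ * _) (_ * _) => *; lra.
Unshelve. all: by end_near. Qed.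

Lemma is_derive_line (x z : R * R) (s : R) : open Omega -> Omega (x + s *: z) ->
  is_derive s 1 (fun t => f (x + t *: z))
    (z.1 * partial1 f (x + s *: z) + z.2 * partial2 f (x + s *: z)).
Proof.
move=> oO; set p := x + s *: z => Op.
have lim : h^-1 *: (((fun t => f (x + t *: z)) \o shift s) (h *: 1) - f p) @[h --> 0^']
   --> z.1 * partial1 f p + z.2 * partial2 f p.
  apply/cvgrPdist_le => e e0.
  pose L := `|z.1| + `|z.2| + 1.
  have L0 : 0 < L by rewrite /L ltr_wpDl // addr_ge0.
  have eL : 0 < e / L by rewrite divr_gt0.
  have to_p : (x + (h + s) *: z) @[h --> 0^'] --> p.
    apply: cvg_within_filter.
    have -> : p = x + (0 + s) *: z by rewrite add0r.
    by apply: cvgD; [exact: cvg_cst|apply: cvgZl; apply: cvgD; [exact: cvg_id|exact: cvg_cst]].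
  have /to_p H := C1_expansion oO Op eL.
  near=> h.
  have h0 : h != 0 by near: h; exact: nbhs_dnbhs_neq.
  have Hh : `|f (x + (h + s) *: z) - f p - ((h * z.1) * partial1 f p + (h * z.2) * partial2 f p)|
      <= e / L * (`|h * z.1| + `|h * z.2|).
    have -> : h * z.1 = (x + (h + s) *: z).1 - p.1 by rewrite /p /= /GRing.scale /=; ring.
    have -> : h * z.2 = (x + (h + s) *: z).2 - p.2 by rewrite /p /= /GRing.scale /=; ring.
    by near: h.
  rewrite distrC /= /GRing.scale /= mulr1.
  have -> : h^-1 * (f (x + (h + s) *: z) - f p) - (z.1 * partial1 f p + z.2 * partial2 f p) =
     h^-1 * (f (x + (h + s) *: z) - f p - ((h * z.1) * partial1 f p + (h * z.2) * partial2 f p)).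
    by field.
  rewrite normrM normfV ler_pdivrMl ?normr_gt0 // (le_trans Hh) // !normrM.
  have -> : e / L * (`|h| * `|z.1| + `|h| * `|z.2|) =
      `|h| * (e * ((`|z.1| + `|z.2|) / L)) by ring.
  rewrite ler_wpM2l // ler_piMr ?ltW // ltr_pdivrMr // mul1r /L.
  by rewrite ltrDl.
by apply: DeriveDef; [apply/cvg_ex; eexists; exact: lim|exact: cvg_lim lim].
Unshelve. all: by end_near. Qed.

End C1_functions.

(** * Dilations of an admissible disc *)

Section dilations.
Context {R : realType}.
Notation K := [set z : R * R | z.1 ^+ 2 + z.2 ^+ 2 <= 1].

Lemma continuous_dilation (x : R * R) : continuous (fun q : R * (R * R) => x + q.1 *: q.2).
Proof.
move=> q; apply: cvgD; first exact: cvg_cst.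
by apply: cvgZ; [exact: cvg_fst|exact: cvg_snd].
Qed.

Lemma enorm_scale_lt (s r : R) (z : R * R) :
  `|s| < r -> K z -> enorm (s *: z) < r.
Proof.
move=> sr Kz; have r0 : 0 < r by exact: le_lt_trans sr.
rewrite /enorm -[ltRHS]gtr0_norm // -[ltRHS]sqrtr_sqr ltr_sqrt ?exprn_gt0 //.
rewrite /= /GRing.scale /= !exprMn -mulrDr -(real_normK (num_real s)).
have s0 := normr_ge0 s; have := Kz; rewrite /= => k.
apply: (@le_lt_trans _ _ (`|s| ^+ 2)); last by rewrite ltr_sqr // ?nnegrE // ltW.
by rewrite ler_piMr // exprn_ge0.
Qed.

(** The closed disc is compact and [Omega] is open, so a slightly larger disc
still fits.  This turns [r] into an interior point of the range of radii, where
the means below are differentiable. *)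
Lemma admissible_dilation (Omega : set (R * R)) (x : R * R) (r : R) :
  open Omega -> admissible_disc Omega x r ->
  exists2 rho, r < rho &
    forall (s : R) z, `|s| < rho -> K z -> Omega (x + s *: z).
Proof.
move=> oO [r0 cl].
have in_disc s z : `|s| < r -> K z -> disc x r (x + s *: z).
  by move=> sr Kz; rewrite /disc /= addrAC subrr add0r; exact: enorm_scale_lt.
have on_circle z : K z -> Omega (x + r *: z).
  move=> Kz; apply: cl => B.
  have to_r : x + s *: z @[s --> r^'-] --> x + r *: z.
    apply: cvg_at_left_filter.
    by apply: cvgD; [exact: cvg_cst|apply: cvgZl; exact: cvg_id].
  move=> /to_r; rewrite /= => Bs.
  have [s [[Bsz sr] s0]] : exists s, (B (x + s *: z) /\ s < r) /\ 0 < s.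
    apply: (@filter_ex _ (r^'-)); near=> s; split; last by near: s; exact: nbhs_left_gt.
    split; first by near: s; exact: Bs.
    by near: s; exact: nbhs_left_lt.
  by exists (x + s *: z); split => //; apply: in_disc => //; rewrite gtr0_norm.
have /compact_near_coveringP cK := @compact_closed_unit_disc R.
have [d /= d0 dO] : \forall s \near r, K `<=` (fun z => Omega (x + s *: z)).
  apply: (cK R (nbhs r) (fun s z => Omega (x + s *: z))) => z Kz.
  have : nbhs (x + r *: z) Omega by apply: open_nbhs_nbhs; split => //; exact: on_circle.
  move=> /(@continuous_dilation x (r, z)) [[P Q] [/= rP zQ] PQ].
  by exists (Q, P) => //= -[w s] [/= Qw Ps]; exact: (PQ (s, w)).
exists (r + d); first by rewrite ltrDl.
have pos s z : 0 <= s -> s < r + d -> K z -> Omega (x + s *: z).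
  move=> s0 sd Kz; have [sr|rs] := ltP s r.
    by apply: cl; apply: subset_closure; apply: in_disc => //; rewrite ger0_norm.
  by apply: dO => //=; rewrite distrC ger0_norm ?subr_ge0 // ltrBlDl.
move=> s z; have [s0|s0] := leP 0 s; first by move=> + Kz; rewrite ger0_norm // => ?; exact: pos.
rewrite ltr0_norm // => sd Kz; rewrite -[s *: z]opprK -scaleNr -scalerN; apply: pos => //.
  by rewrite oppr_ge0 ltW.
by rewrite /= !sqrrN.
Unshelve. all: by end_near. Qed.

Variables (Omega : set (R * R)) (x : R * R) (rho : R).
Hypothesis Orho : forall (s : R) z, `|s| < rho -> K z -> Omega (x + s *: z).

Lemma bounded_dilation (f : R * R -> R) (r1 : R) : r1 < rho ->
  (forall p, Omega p -> {for p, continuous f}) ->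
  exists2 M, 0 <= M & forall (s : R) z, `|s| <= r1 -> K z -> `|f (x + s *: z)| <= M.
Proof.
move=> r1rho cf.
pose A := `[(- r1), r1]%classic `*` K.
pose F (q : R * (R * R)) := f (x + q.1 *: q.2).
have [M [_ FM]] : bounded_set (F @` A).
  apply: compact_bounded; apply: continuous_compact.
    apply: continuous_in_subspaceT => -[s z]; rewrite inE /A /= in_itv /= => -[sr Kz].
    apply: (@continuous_comp _ _ _ (fun q : R * (R * R) => x + q.1 *: q.2) f).
      exact: continuous_dilation.
    by apply: cf; apply: Orho => //=; rewrite (le_lt_trans _ r1rho) // ler_norml.
  by apply: compact_setX; [exact: segment_compact|exact: compact_closed_unit_disc].
exists (Num.max 0 M + 1); first by rewrite addr_ge0 // le_max lexx.
move=> s z sr Kz; apply: FM; first by rewrite ltr_pwDr // le_max lexx orbT.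
by exists (s, z) => //; split => //=; rewrite in_itv /= -ler_norml.
Qed.

End dilations.

(** * Differentiating under the integral over dilated discs *)

Section dilated_integrals.
Context {R : realType}.
Notation D := (@unit_disc R).
Notation K := [set z : R * R | z.1 ^+ 2 + z.2 ^+ 2 <= 1].
Variables (Omega : set (R * R)) (x : R * R) (rho : R).
Hypothesis oO : open Omega.
Hypothesis Orho : forall (s : R) z, `|s| < rho -> K z -> Omega (x + s *: z).
Let mD := @measurable_unit_disc R.

Lemma continuous_dilate (f : R * R -> R) (s : R) z :
  (forall p, Omega p -> {for p, continuous f}) -> `|s| < rho -> K z ->
  {for z, continuous (fun w : R * R => f (x + s *: w))}.
Proof.
move=> cf srho Kz; apply: (@continuous_comp _ _ _ (fun w : R * R => x + s *: w) f).
  by apply: cvgD; [exact: cvg_cst|apply: cvgZr; exact: cvg_id].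
by apply: cf; exact: Orho.
Qed.

Lemma integrable_dilateM (f phi : R * R -> R) (s : R) :
  (forall p, Omega p -> {for p, continuous f}) ->
  (leb2 R).-integrable D (EFin \o phi) -> `|s| < rho ->
  (leb2 R).-integrable D (EFin \o (fun z => f (x + s *: z) * phi z)).
Proof.
move=> cf iphi srho.
have [M M0 fM] := bounded_dilation Orho srho cf.
apply: (@integrableMr _ _ _ _ _ mD (fun z => f (x + s *: z)) (EFin \o phi)) => //.
  apply: continuous_on_measurable; first exact: open_unit_disc.
  by move=> z /ltW Kz; exact: continuous_dilate.
exists M; split; rewrite ?num_real // => N MN z /ltW Kz.
apply: le_trans (ltW MN); exact: fM.
Qed.

(** Up to a radius strictly between [|s|] and [rho] the partial derivatives of
[f] are bounded, so a multiple of [|phi|] dominates the derivatives of the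
integrand and one may differentiate under the integral sign. *)
Lemma is_derive_disc_integral (f phi : R * R -> R) (s : R) :
  C1_on Omega f -> (leb2 R).-integrable D (EFin \o phi) -> `|s| < rho ->
  is_derive s 1 (fun t => \int[leb2 R]_(z in D) (f (x + t *: z) * phi z))
    (\int[leb2 R]_(z in D)
       ((z.1 * partial1 f (x + s *: z) + z.2 * partial2 f (x + s *: z)) * phi z)).
Proof.
move=> C1f iphi srho; have [_ _ c1 c2] := C1f.
have cf := C1_continuous C1f oO.
pose r1 := (`|s| + rho) / 2.
have sr1 : `|s| < r1 by rewrite /r1; lra.
have r1rho : r1 < rho by rewrite /r1; lra.
have [M1 M10 fM1] := bounded_dilation Orho r1rho c1.
have [M2 M20 fM2] := bounded_dilation Orho r1rho c2.
pose F (t : R) (z : R * R) := f (x + t *: z) * phi z.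
have dF (t : R) z : `|t| < rho -> D z -> is_derive t 1 (F ^~ z)
    ((z.1 * partial1 f (x + t *: z) + z.2 * partial2 f (x + t *: z)) * phi z).
  move=> trho /ltW Kz.
  have dl := is_derive_line C1f oO (Orho trho Kz).
  rewrite (_ : F ^~ z = phi z \*: (fun t => f (x + t *: z))); last first.
    by apply/funext => u; rewrite /F mulrC.
  by apply: is_derive_eq; rewrite /GRing.scale /= mulrC.
have partialF (t : R) z : `|t| < rho -> D z -> partial1of2 F t z =
    (z.1 * partial1 f (x + t *: z) + z.2 * partial2 f (x + t *: z)) * phi z.
  by move=> trho Dz; rewrite partial1of2E; have [] := dF _ _ trho Dz.
have Is : `]- r1, r1[%classic s by rewrite /= in_itv /= -ltr_norml.
have It (t : R) : `]- r1, r1[%classic t -> `|t| < r1 by rewrite /= in_itv /= -ltr_norml.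
have It' (t : R) : `]- r1, r1[%classic t -> `|t| < rho by move/It => /lt_trans; exact.
have intF (t : R) : `]- r1, r1[%classic t -> (leb2 R).-integrable D (EFin \o F t).
  by move=> /It' tr; exact: integrable_dilateM.
have derF (t : R) z : `]- r1, r1[%classic t -> D z -> derivable (F ^~ z) t 1.
  by move=> /It' tr Dz; have [] := dF _ _ tr Dz.
pose G (z : R * R) := (M1 + M2) * `|phi z|.
have G0 z : 0 <= G z by rewrite mulr_ge0 // addr_ge0.
have iG : (leb2 R).-integrable D (EFin \o G).
  rewrite (_ : EFin \o G = fun z => ((M1 + M2)%:E * (`|phi z|)%:E)%E) //.
  by apply: integrableZl => //; exact: (integrable_abse iphi).
have GM (t : R) z : `]- r1, r1[%classic t -> D z -> `|partial1of2 F t z| <= G z.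
  move=> tI Dz; rewrite partialF //; last exact: It'.
  rewrite normrM ler_wpM2r // (le_trans (ler_normD _ _)) // !normrM.
  have Kz : K z by exact: ltW.
  have := fM1 _ _ (ltW (It _ tI)) Kz; have := fM2 _ _ (ltW (It _ tI)) Kz.
  have [z1 z2] : `|z.1| <= 1 /\ `|z.2| <= 1.
    rewrite !ler_norml; move: Dz; rewrite /unit_disc /= => Dz.
    by split; apply/andP; split; nra.
  move=> h2 h1; apply: lerD.
    by rewrite (le_trans _ h1) // ler_piMl.
  by rewrite (le_trans _ h2) // ler_piMl.
have E : \int[leb2 R]_(z in D) partial1of2 F s z = \int[leb2 R]_(z in D)
       ((z.1 * partial1 f (x + s *: z) + z.2 * partial2 f (x + s *: z)) * phi z).
  by apply: eq_Rintegral => z; rewrite inE => Dz; exact: partialF.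
apply: DeriveDef.
  exact: (derivable_under_integral mD Is intF derF G0 iG GM).
rewrite -E -derive1E.
exact: (differentiation_under_integral mD Is intF derF G0 iG GM).
Qed.

Lemma disc_integral_le (f phi : R * R -> R) (M s : R) :
  (forall p, Omega p -> {for p, continuous f}) ->
  (leb2 R).-integrable D (EFin \o phi) -> `|s| < rho ->
  (forall z, D z -> `|f (x + s *: z)| <= M) ->
  (forall z, D z -> `|phi z| <= 1) -> 0 <= M ->
  `|\int[leb2 R]_(z in D) (f (x + s *: z) * phi z)| <= M * pi.
Proof.
move=> cf iphi srho fM phi1 M0.
have ifp := integrable_dilateM cf iphi srho.
apply: (le_trans (le_normr_Rintegral mD ifp)).
have iM : (leb2 R).-integrable D (EFin \o cst M).
  by apply: integrable_disc_continuous => z _; exact: cst_continuous.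
have -> : M * pi = \int[leb2 R]_(z in D) (cst M z).
  rewrite /Rintegral (@integral_cst _ _ _ (leb2 R) D mD M%:E).
  by rewrite -[LHS]/(fine (M%:E * pi%:E)) -area_unit_disc.
apply: le_Rintegral => //; first exact: (integrable_abse ifp).
move=> z Dz; rewrite normrM -[leRHS]mulr1 ler_pM //; [exact: fM|exact: phi1].
Qed.

End dilated_integrals.

(** * The logarithmic kernel *)

(** This is [ln (1 / |z|)]; the convention [ln 0 = 0] gives it the value [0] at
the origin. *)
Definition log_kernel {R : realType} (z : R * R) : R :=
  - ln (z.1 ^+ 2 + z.2 ^+ 2) / 2.

Section log_kernel.
Context {R : realType}.
Notation D := (@unit_disc R).
Notation mu := (@lebesgue_measure R).
Let mD := @measurable_unit_disc R.

Lemma log_kernel_ge0 (z : R * R) : D z -> 0 <= log_kernel z.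
Proof.
by rewrite /unit_disc /log_kernel /= => /ltW /ln_le0 ?; rewrite divr_ge0 // oppr_ge0.
Qed.

Lemma log_kernel_sphere (z : R * R) : z.1 ^+ 2 + z.2 ^+ 2 = 1 -> log_kernel z = 0.
Proof. by rewrite /log_kernel => ->; rewrite ln1 oppr0 mul0r. Qed.

Let is_derive_log (a c : R) : 0 < a ^+ 2 + c ->
  is_derive a 1 (fun t => - ln (t ^+ 2 + c) / 2) (- (a / (a ^+ 2 + c))).
Proof.
move=> q0; have dl := is_derive1_ln q0.
have dq : is_derive a 1 (fun t : R => t ^+ 2 + c) (a *+ 2).
  by apply: is_derive_eq; rewrite /GRing.scale /=; ring.
have dc := @is_derive1_comp _ (@ln R) (fun t : R => t ^+ 2 + c) a _ _ dl dq.
rewrite (_ : (fun t => _) = (- 2^-1) \*: (@ln R \o (fun t : R => t ^+ 2 + c))); last first.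
  by apply/funext => t /=; rewrite /GRing.scale /=; field.
by apply: is_derive_eq; rewrite /GRing.scale /=; field; rewrite gt_eqF.
Qed.

Lemma is_derive_log_kernel1 (a b : R) : b != 0 ->
  is_derive a 1 (fun t => log_kernel (t, b)) (- (a / (a ^+ 2 + b ^+ 2))).
Proof. by move=> b0; exact: (is_derive_log (sqnorm_gt0_snd a b0)). Qed.

Lemma is_derive_log_kernel2 (a b : R) : a != 0 ->
  is_derive b 1 (fun t => log_kernel (a, t)) (- (b / (a ^+ 2 + b ^+ 2))).
Proof.
move=> a0.
have -> : (fun t : R => log_kernel (a, t)) = (fun t => - ln (t ^+ 2 + a ^+ 2) / 2).
  by apply/funext => t; rewrite /log_kernel /= addrC.
by rewrite addrC; apply: is_derive_log; exact: sqnorm_gt0_snd.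
Qed.

Lemma measurable_log_kernel :
  measurable_fun [set: measurableTypeR R * measurableTypeR R] (@log_kernel R).
Proof.
pose q (z : R * R) : R := z.1 ^+ 2 + z.2 ^+ 2.
rewrite (_ : log_kernel = (fun u : R => u * (- 2^-1)) \o (@ln R \o q)); last first.
  by apply/funext => z; rewrite /log_kernel /q /=; field.
apply: measurableT_comp; first exact: mulrr_measurable.
apply: measurableT_comp; first exact: measurable_ln.
by apply: continuous_on_measurable; [exact: openT|move=> z _; exact: continuous_sqnorm].
Qed.

Let measurable_restr :
  measurable_fun [set: measurableTypeR R * measurableTypeR R] ((EFin \o @log_kernel R) \_ D).
Proof.
apply: (measurable_restrictT (EFin \o @log_kernel R) mD).1.
by apply/measurable_EFinP; apply: measurable_funS measurable_log_kernel => //.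
Qed.

(** On the chord at height [b] the derivative of [t * log_kernel (t, b) + t] is
at least [log_kernel (t, b)], and its integral is the length of the chord, which
does not see how close the chord is to the singularity. *)
Let chord_le2 (b : R) : b != 0 ->
  (\int[mu]_a ((EFin \o @log_kernel R) \_ D) (a, b)
    <= ((cst 2%:E : R -> \bar R) \_ `[(- 1)%R, 1%R]) b)%E.
Proof.
move=> b0; rewrite section1_unit_disc /=.
set h := Num.sqrt (1 - b ^+ 2).
have [b1|b1] := ltP 1 (b ^+ 2).
  rewrite /h ler0_sqrtr ?oppr0 ?set_itvoo0 ?integral_set0; last by lra.
  by rewrite patchE; case: ifP => _ /=; rewrite ?lee_fin.
have -> : ((cst 2%:E : R -> \bar R) \_ `[(- 1)%R, 1%R]) b = 2%:E.
  by rewrite patchE ifT // mem_setE in_itv /=; apply/andP; split; nra.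
have h0 : 0 <= h by exact: sqrtr_ge0.
have h1 : h <= 1.
  by rewrite -[leRHS]sqrtr1 ler_wsqrtr //; have := sqr_ge0 b; lra.
have q0 t := sqnorm_gt0_snd t b0.
pose F t := t * log_kernel (t, b) + t.
pose g t := log_kernel (t, b) + b ^+ 2 / (t ^+ 2 + b ^+ 2).
have cl (t : R) : {for t, continuous (fun t : R => log_kernel (t, b))}.
  by apply/differentiable_continuous/derivable1_diffP; have [] := is_derive_log_kernel1 t b0.
have cq (t : R) : {for t, continuous (fun t : R => b ^+ 2 / (t ^+ 2 + b ^+ 2))}.
  apply: cvgM; first exact: cvg_cst.
  apply: cvgV; first by rewrite gt_eqF.
  by apply: cvgD; [exact: exprn_continuous|exact: cvg_cst].
have dF (t : R) : is_derive t 1 F (g t).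
  have dl := is_derive_log_kernel1 t b0.
  apply: (is_derive_eq (is_deriveD (is_deriveM (is_derive_id t 1) dl) (is_derive_id t 1))).
  by rewrite /g /GRing.scale /=; field; rewrite gt_eqF.
have cg (t : R) : {for t, continuous g} by apply: cvgD; [exact: cl|exact: cq].
have in_disc (t : R) : `](- h), h[%classic t -> D (t, b).
  by rewrite /unit_disc /= lt_sqr_chord.
have meas (k : R -> R) : (forall t : R, {for t, continuous k}) ->
    measurable_fun (`](- h), h[%classic : set (measurableTypeR R)) (EFin \o k).
  move=> ck; apply/measurable_EFinP; apply: measurable_funS (continuous_measurable_fun _) => //.
apply: (@le_trans _ _ (\int[mu]_(t in `](- h)%R, h[) (g t)%:E)%E).
  apply: ge0_le_integral => //.
  - by move=> t th; rewrite lee_fin; exact: log_kernel_ge0 (in_disc t th).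
  - exact: (meas (fun t => log_kernel (t, b))).
  - exact: meas.
  - by move=> t _; rewrite lee_fin lerDl divr_ge0 ?sqr_ge0 // ltW.
have -> : (\int[mu]_(t in `](- h)%R, h[) (g t)%:E = (F h - F (- h))%:E)%E.
  by apply: integral_derivative_chord.
have hb : h ^+ 2 + b ^+ 2 = 1 by rewrite sqr_sqrtr ?subr_ge0 // subrK.
rewrite lee_fin /F !log_kernel_sphere ?sqrrN //=.
by lra.
Qed.

Lemma integrable_log_kernel : (leb2 R).-integrable D (EFin \o @log_kernel R).
Proof.
apply/(integrable_mkcond _ mD).2.
apply/(integrable21ltyP _ _ measurable_restr).2.
have mabs : measurable_fun [set: measurableTypeR R * measurableTypeR R]
   (fun z => `|((EFin \o @log_kernel R) \_ D) z|%E).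
  by apply: measurableT_comp measurable_restr; exact: abse_measurable.
have E z : `|((EFin \o @log_kernel R) \_ D) z|%E = ((EFin \o @log_kernel R) \_ D) z.
  by rewrite patchE; case: ifPn => [/set_mem Dz|_]; rewrite gee0_abs // lee_fin log_kernel_ge0.
apply: (@le_lt_trans _ _ (\int[mu]_b ((cst 2%:E : R -> \bar R) \_ `[(- 1)%R, 1%R]) b)%E).
  apply: ae_ge0_le_integral => //.
  - by move=> b _; apply: integral_ge0.
  - exact: (measurable_fun_fubini_tonelli_G _ mabs (fun z => abse_ge0 _)).
  - by move=> b _; rewrite patchE; case: ifP => _ /=; rewrite ?lee_fin.
  - by apply: (measurable_restrictT _ _).1.
  apply: filterS (ae_neq0 (R := R)) => b b0 _.
  apply: le_trans (chord_le2 b0).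
  by under eq_integral do rewrite E.
rewrite -integral_mkcond integral_cst //= lebesgue_measure_itv /= lte_fin.
by case: ifP => _; rewrite -?EFinM -?EFinD ltry.
Qed.

End log_kernel.

(** * Integration by parts against the radial weights *)

Section by_parts.
Context {R : realType}.
Notation D := (@unit_disc R).
Notation K := [set z : R * R | z.1 ^+ 2 + z.2 ^+ 2 <= 1].
Variables (Omega : set (R * R)) (x : R * R) (rho : R).
Hypothesis oO : open Omega.
Hypothesis Orho : forall (s : R) z, `|s| < rho -> K z -> Omega (x + s *: z).
Let mD := @measurable_unit_disc R.

Lemma is_derive_dilate1 (f : R * R -> R) (s a b : R) : C1_on Omega f ->
  `|s| < rho -> K (a, b) ->
  is_derive a 1 (fun t => f (x + s *: (t, b))) (s * partial1 f (x + s *: (a, b))).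
Proof.
move=> C1f srho Kab.
have E (t : R) : x + s *: ((t, b) : R * R) = (x + s *: ((0, b) : R * R)) + t *: ((s, 0) : R * R).
  rewrite -addrA; congr (_ + _).
  by congr pair; rewrite /= /GRing.scale /= ?mulr0 ?addr0 ?add0r // mulrC.
have := Orho srho Kab; rewrite E => /(is_derive_line C1f oO).
rewrite /= mul0r addr0 -E => dl.
rewrite (_ : (fun t => _) = (fun t => f (x + s *: (0, b) + t *: (s, 0)))) //.
by apply/funext => t; rewrite E.
Qed.

Lemma is_derive_dilate2 (f : R * R -> R) (s a b : R) : C1_on Omega f ->
  `|s| < rho -> K (a, b) ->
  is_derive b 1 (fun t => f (x + s *: (a, t))) (s * partial2 f (x + s *: (a, b))).
Proof.
move=> C1f srho Kab.
have E (t : R) : x + s *: ((a, t) : R * R) = (x + s *: ((a, 0) : R * R)) + t *: ((0, s) : R * R).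
  rewrite -addrA; congr (_ + _).
  by congr pair; rewrite /= /GRing.scale /= ?mulr0 ?addr0 ?add0r // mulrC.
have := Orho srho Kab; rewrite E => /(is_derive_line C1f oO).
rewrite /= mul0r add0r -E => dl.
rewrite (_ : (fun t => _) = (fun t => f (x + s *: (a, 0) + t *: (0, s)))) //.
by apply/funext => t; rewrite E.
Qed.

(** As [z.1 * weight k z] is, up to sign, a partial derivative of [weight k.+1],
which vanishes on the circle, integration by parts moves the derivative to [f]. *)
Lemma weight_by_parts1 (f : R * R -> R) (k : nat) (s : R) :
  C1_on Omega f -> `|s| < rho ->
  \int[leb2 R]_(z in D) (f (x + s *: z) * (z.1 * weight k z)) =
  s * \int[leb2 R]_(z in D) (partial1 f (x + s *: z) * weight k.+1 z).
Proof.
move=> C1f srho; have [_ _ c1 _] := C1f.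
have iW : (leb2 R).-integrable D (EFin \o (fun z => z.1 * weight k z)).
  apply: integrable_disc_continuous => z _.
  by apply: cvgM; [exact: cvg_fst|exact: continuous_weight].
have i1 := integrable_dilateM Orho (C1_continuous C1f oO) iW srho.
have i2 := integrable_dilateM Orho c1 (integrable_weight k.+1) srho.
have i2s : (leb2 R).-integrable D
    (EFin \o (fun z => s * (partial1 f (x + s *: z) * weight k.+1 z))).
  exact: (integrableZl mD s i2).
apply/esym/eqP; rewrite -subr_eq0 -RintegralZl // -RintegralB //; apply/eqP.
apply: (@integral_disc_deriv1 _ (fun z => f (x + s *: z) * weight k.+1 z)).
- exact: (integrableB mD i2s i1).
- move=> a b _ Kab.
  apply: (is_derive_eq (is_deriveM (is_derive_dilate1 C1f srho Kab) (is_derive_weight1 k a b))).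
  by rewrite /GRing.scale /=; ring.
- move=> a b _ Kab.
  apply: (@continuous_slice1 _ (fun z => s * (partial1 f (x + s *: z) * weight k.+1 z)
                     - f (x + s *: z) * (z.1 * weight k z))).
  apply: cvgB.
    apply: cvgM; first exact: cvg_cst.
    apply: cvgM; last exact: continuous_weight.
    exact: (@continuous_dilate _ _ _ _ Orho _ s (a, b) c1 srho Kab).
  apply: cvgM.
    exact: (@continuous_dilate _ _ _ _ Orho _ s (a, b) (C1_continuous C1f oO) srho Kab).
  by apply: cvgM; [exact: cvg_fst|exact: continuous_weight].
- by move=> a b _ /(@weight_sphere _ k (a, b)) ->; rewrite mulr0.
Qed.

Lemma weight_by_parts2 (f : R * R -> R) (k : nat) (s : R) :
  C1_on Omega f -> `|s| < rho ->
  \int[leb2 R]_(z in D) (f (x + s *: z) * (z.2 * weight k z)) =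
  s * \int[leb2 R]_(z in D) (partial2 f (x + s *: z) * weight k.+1 z).
Proof.
move=> C1f srho; have [_ _ _ c2] := C1f.
have iW : (leb2 R).-integrable D (EFin \o (fun z => z.2 * weight k z)).
  apply: integrable_disc_continuous => z _.
  by apply: cvgM; [exact: cvg_snd|exact: continuous_weight].
have i1 := integrable_dilateM Orho (C1_continuous C1f oO) iW srho.
have i2 := integrable_dilateM Orho c2 (integrable_weight k.+1) srho.
have i2s : (leb2 R).-integrable D
    (EFin \o (fun z => s * (partial2 f (x + s *: z) * weight k.+1 z))).
  exact: (integrableZl mD s i2).
apply/esym/eqP; rewrite -subr_eq0 -RintegralZl // -RintegralB //; apply/eqP.
apply: (@integral_disc_deriv2 _ (fun z => f (x + s *: z) * weight k.+1 z)).
- exact: (integrableB mD i2s i1).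
- move=> a b _ Kab.
  apply: (is_derive_eq (is_deriveM (is_derive_dilate2 C1f srho Kab) (is_derive_weight2 k a b))).
  by rewrite /GRing.scale /=; ring.
- move=> a b _ Kab.
  apply: (@continuous_slice2 _ (fun z => s * (partial2 f (x + s *: z) * weight k.+1 z)
                     - f (x + s *: z) * (z.2 * weight k z))).
  apply: cvgB.
    apply: cvgM; first exact: cvg_cst.
    apply: cvgM; last exact: continuous_weight.
    exact: (@continuous_dilate _ _ _ _ Orho _ s (a, b) c2 srho Kab).
  apply: cvgM.
    exact: (@continuous_dilate _ _ _ _ Orho _ s (a, b) (C1_continuous C1f oO) srho Kab).
  by apply: cvgM; [exact: cvg_snd|exact: continuous_weight].
- by move=> a b _ /(@weight_sphere _ k (a, b)) ->; rewrite mulr0.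
Qed.

End by_parts.

(** * Integration by parts against the logarithmic kernel *)

(** The square of the sine of the polar angle, [z.2 ^+ 2 / |z| ^+ 2] off the
origin.  Writing [|z| ^- 2] as an exponential makes measurability immediate.
The square of the cosine is represented by [1 - sqr_sine z], so that the two
add up to [1] at the origin as well. *)
Definition sqr_sine {R : realType} (z : R * R) : R :=
  z.2 ^+ 2 * expR (2 * log_kernel z).

Section by_parts_log.
Context {R : realType}.
Notation D := (@unit_disc R).
Notation K := [set z : R * R | z.1 ^+ 2 + z.2 ^+ 2 <= 1].
Variables (Omega : set (R * R)) (x : R * R) (rho : R).
Hypothesis oO : open Omega.
Hypothesis Orho : forall (s : R) z, `|s| < rho -> K z -> Omega (x + s *: z).
Let mD := @measurable_unit_disc R.

Lemma sqr_sineE (z : R * R) : 0 < z.1 ^+ 2 + z.2 ^+ 2 ->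
  sqr_sine z = z.2 ^+ 2 / (z.1 ^+ 2 + z.2 ^+ 2).
Proof.
move=> q0; rewrite /sqr_sine /log_kernel (mulrC 2) divfK ?pnatr_eq0 //.
by rewrite expRN lnK ?posrE.
Qed.

Lemma sqr_sine_bound (z : R * R) : 0 <= sqr_sine z <= 1.
Proof.
have z1 := sqr_ge0 z.1; have z2 := sqr_ge0 z.2.
have [q0|q0] := ltP 0 (z.1 ^+ 2 + z.2 ^+ 2).
  by rewrite sqr_sineE // divr_ge0 ?(ltW q0) //= ler_pdivrMr // mul1r lerDr.
have z20 : z.2 ^+ 2 = 0 by lra.
by rewrite /sqr_sine z20 mul0r lexx ler01.
Qed.

Lemma continuous_log_kernel (z : R * R) : 0 < z.1 ^+ 2 + z.2 ^+ 2 ->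
  {for z, continuous (@log_kernel R)}.
Proof.
move=> q0; apply: cvgM; last exact: cvg_cst.
apply: cvgN; apply: (@continuous_comp _ _ _ (fun z : R * R => z.1 ^+ 2 + z.2 ^+ 2) (@ln R)).
  exact: continuous_sqnorm.
exact: continuous_ln.
Qed.

Lemma continuous_sqr_sine (z : R * R) : 0 < z.1 ^+ 2 + z.2 ^+ 2 ->
  {for z, continuous (@sqr_sine R)}.
Proof.
move=> q0; apply: cvgM.
  exact: continuous_sqr2.
apply: (@continuous_comp _ _ _ (fun z => 2 * log_kernel z) expR); last exact: continuous_expR.
by apply: cvgM; [exact: cvg_cst|exact: continuous_log_kernel].
Qed.

Let measurable_snd2 : measurable_fun [set: measurableTypeR R * measurableTypeR R]
  (fun z : R * R => z.2 ^+ 2 : R).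
Proof.
apply: continuous_on_measurable; [exact: openT|move=> z _].
exact: continuous_sqr2.
Qed.

Lemma integrable_sqr_sine : (leb2 R).-integrable D (EFin \o @sqr_sine R).
Proof.
apply: (@integrable_disc_bounded _ _ 1).
  apply: (@measurable_funS _ _ _ _ setT) => //.
  apply: measurable_funM; first exact: measurable_snd2.
  apply: measurableT_comp; first exact: measurable_expR.
  by apply: measurable_funM; [exact: measurable_cst|exact: measurable_log_kernel].
by move=> z _; have /andP[? ?] := sqr_sine_bound z; rewrite ger0_norm.
Qed.

Let integrable_coordM (c : R * R -> R) :
  continuous c -> (forall z, D z -> `|c z| <= 1) ->
  (leb2 R).-integrable D (EFin \o (fun z => c z * log_kernel z)).
Proof.
move=> cc c1; apply: (@integrableMr _ _ _ _ _ mD c (EFin \o @log_kernel R)).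
- by apply: continuous_on_measurable; [exact: open_unit_disc|move=> z _; exact: cc].
- exists 1; split; rewrite ?num_real // => N N1 z Dz /=.
  by apply: le_trans (ltW N1); exact: c1.
- exact: integrable_log_kernel.
Qed.

Let fst_le1 (z : R * R) : D z -> `|z.1| <= 1.
Proof. by rewrite /unit_disc /= ler_norml => h; apply/andP; split; nra. Qed.

Let snd_le1 (z : R * R) : D z -> `|z.2| <= 1.
Proof. by rewrite /unit_disc /= ler_norml => h; apply/andP; split; nra. Qed.

Lemma integrable_fst_log : (leb2 R).-integrable D (EFin \o (fun z => z.1 * log_kernel z)).
Proof.
by apply: integrable_coordM => [z|]; [exact: cvg_fst|exact: fst_le1].
Qed.

Lemma integrable_snd_log : (leb2 R).-integrable D (EFin \o (fun z => z.2 * log_kernel z)).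
Proof.
by apply: integrable_coordM => [z|]; [exact: cvg_snd|exact: snd_le1].
Qed.

Let integrable_sub (f g : R * R -> R) :
  (leb2 R).-integrable D (EFin \o f) -> (leb2 R).-integrable D (EFin \o g) ->
  (leb2 R).-integrable D (EFin \o (fun z => f z - g z)).
Proof. by move=> i_f ig; exact: (integrableB mD i_f ig). Qed.

Lemma integrable_log1 :
  (leb2 R).-integrable D (EFin \o (fun z => log_kernel z - (1 - sqr_sine z))).
Proof.
apply: integrable_sub; first exact: integrable_log_kernel.
apply: (@integrable_sub (cst 1)); last exact: integrable_sqr_sine.
by apply: (@integrable_disc_continuous _ (cst 1)) => z _; exact: cst_continuous.
Qed.

Lemma integrable_log2 :
  (leb2 R).-integrable D (EFin \o (fun z => log_kernel z - sqr_sine z)).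
Proof.
by apply: integrable_sub; [exact: integrable_log_kernel|exact: integrable_sqr_sine].
Qed.

(** Off the origin, the partial derivative of [z.1 * log_kernel z] along the
first axis is [log_kernel z] minus the square of the cosine of the polar angle. *)
Lemma log_by_parts1 (f : R * R -> R) (s : R) : C1_on Omega f -> `|s| < rho ->
  \int[leb2 R]_(z in D) (f (x + s *: z) * (log_kernel z - (1 - sqr_sine z))) +
  s * \int[leb2 R]_(z in D) (partial1 f (x + s *: z) * (z.1 * log_kernel z)) = 0.
Proof.
move=> C1f srho; have [_ _ c1 _] := C1f.
have i1 := integrable_dilateM Orho (C1_continuous C1f oO) integrable_log1 srho.
have i2 := integrable_dilateM Orho c1 integrable_fst_log srho.
have i2s : (leb2 R).-integrable D
    (EFin \o (fun z => s * (partial1 f (x + s *: z) * (z.1 * log_kernel z)))).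
  exact: (integrableZl mD s i2).
rewrite -RintegralZl // -RintegralD //.
apply: (@integral_disc_deriv1 _ (fun z => f (x + s *: z) * (z.1 * log_kernel z))).
- exact: (integrableD mD i1 i2s).
- move=> a b b0 Kab.
  have dlog := is_deriveM (is_derive_id a 1) (is_derive_log_kernel1 a b0).
  apply: (is_derive_eq (is_deriveM (is_derive_dilate1 oO Orho C1f srho Kab) dlog)).
  rewrite sqr_sineE /GRing.scale /= ?sqnorm_gt0_snd //.
  by rewrite fctE; field; rewrite gt_eqF ?sqnorm_gt0_snd.
- move=> a b b0 Kab.
  have q0 := sqnorm_gt0_snd a b0.
  apply: (@continuous_slice1 _ (fun z => f (x + s *: z) * (log_kernel z - (1 - sqr_sine z)) +
                     s * (partial1 f (x + s *: z) * (z.1 * log_kernel z)))).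
  apply: cvgD.
    apply: cvgM.
      exact: (@continuous_dilate _ _ _ _ Orho _ s (a, b) (C1_continuous C1f oO) srho Kab).
    apply: cvgB; first exact: continuous_log_kernel.
    by apply: cvgB; [exact: cvg_cst|exact: continuous_sqr_sine].
  apply: cvgM; first exact: cvg_cst.
  apply: cvgM; first exact: (@continuous_dilate _ _ _ _ Orho _ s (a, b) c1 srho Kab).
  by apply: cvgM; [exact: cvg_fst|exact: continuous_log_kernel].
- by move=> a b _ /(@log_kernel_sphere _ (a, b)) ->; rewrite !mulr0.
Qed.

Lemma log_by_parts2 (f : R * R -> R) (s : R) : C1_on Omega f -> `|s| < rho ->
  \int[leb2 R]_(z in D) (f (x + s *: z) * (log_kernel z - sqr_sine z)) +
  s * \int[leb2 R]_(z in D) (partial2 f (x + s *: z) * (z.2 * log_kernel z)) = 0.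
Proof.
move=> C1f srho; have [_ _ _ c2] := C1f.
have i1 := integrable_dilateM Orho (C1_continuous C1f oO) integrable_log2 srho.
have i2 := integrable_dilateM Orho c2 integrable_snd_log srho.
have i2s : (leb2 R).-integrable D
    (EFin \o (fun z => s * (partial2 f (x + s *: z) * (z.2 * log_kernel z)))).
  exact: (integrableZl mD s i2).
rewrite -RintegralZl // -RintegralD //.
apply: (@integral_disc_deriv2 _ (fun z => f (x + s *: z) * (z.2 * log_kernel z))).
- exact: (integrableD mD i1 i2s).
- move=> a b a0 Kab.
  have dlog := is_deriveM (is_derive_id b 1) (is_derive_log_kernel2 b a0).
  apply: (is_derive_eq (is_deriveM (is_derive_dilate2 oO Orho C1f srho Kab) dlog)).
  rewrite sqr_sineE /GRing.scale /= ?sqnorm_gt0_fst //.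
  by rewrite fctE; field; rewrite gt_eqF ?sqnorm_gt0_fst.
- move=> a b a0 Kab.
  have q0 := sqnorm_gt0_fst b a0.
  apply: (@continuous_slice2 _ (fun z => f (x + s *: z) * (log_kernel z - sqr_sine z) +
                     s * (partial2 f (x + s *: z) * (z.2 * log_kernel z)))).
  apply: cvgD.
    apply: cvgM.
      exact: (@continuous_dilate _ _ _ _ Orho _ s (a, b) (C1_continuous C1f oO) srho Kab).
    by apply: cvgB; [exact: continuous_log_kernel|exact: continuous_sqr_sine].
  apply: cvgM; first exact: cvg_cst.
  apply: cvgM; first exact: (@continuous_dilate _ _ _ _ Orho _ s (a, b) c2 srho Kab).
  by apply: cvgM; [exact: cvg_snd|exact: continuous_log_kernel].
- by move=> a b _ /(@log_kernel_sphere _ (a, b)) ->; rewrite !mulr0.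
Qed.

End by_parts_log.

(** * Taylor series of a chain of derivatives *)

Section derivation_chain.
Context {R : realType}.
Variables (f : nat -> R -> R) (c r B : R).
Hypothesis c0 : 0 <= c.
Hypothesis r0 : 0 <= r.
Hypothesis df : forall k (s : R), 0 <= s <= r -> is_derive s 1 (f k) (c * s * f k.+1 s).
Hypothesis fB : forall k (s : R), 0 <= s <= r -> `|f k.+1 s| <= B.

Let P n (s : R) : R := (c * s ^+ 2 / 2) ^+ n / n`!%:R.
Let T k n (s : R) : R := \sum_(j < n) f (k + j)%N 0 * P j s.

Let is_derive_P n (s : R) : is_derive s 1 (P n.+1) (c * s * P n s).
Proof.
pose q (t : R) := c * t ^+ 2 / 2.
have dq : is_derive s 1 q (c * s).
  by apply: is_derive_eq; rewrite /GRing.scale /=; field.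
rewrite (_ : P n.+1 = (n.+1)`!%:R^-1 \*: (q ^+ n.+1)); last first.
  by apply/funext => t; rewrite /P /= mulrC !fctE.
apply: is_derive_eq; rewrite /P -/(q s) /GRing.scale /= factS natrM.
have : n`!%:R != 0 :> R by rewrite pnatr_eq0 -lt0n fact_gt0.
have : n.+1%:R != 0 :> R by rewrite pnatr_eq0.
move: (q s ^+ n) => w k0 k1; field.
by rewrite k1 nat1r k0.
Qed.

Let P00 : P 0 = cst 1.
Proof. by apply/funext => s; rewrite /P expr0 fact0 divr1. Qed.

Let PS0 n : P n.+1 0 = 0.
Proof. by rewrite /P expr0n mulr0 mul0r expr0n mul0r. Qed.

Let is_derive_T n k (s : R) : is_derive s 1 (T k n.+1) (c * s * T k.+1 n s).
Proof.
elim: n => [|n IH].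
  rewrite /T big_ord0 mulr0 (_ : (fun _ => _) = cst (f k 0)).
    exact: is_derive_cst.
  by apply/funext => t; rewrite big_ord_recl big_ord0 P00 addn0 mulr1 addr0.
rewrite (_ : T k n.+2 = T k n.+1 + (f (k + n.+1)%N 0 \*: P n.+1)); last first.
  by apply/funext => t; rewrite /T big_ord_recr.
have dP := is_derive_P n s.
apply: is_derive_eq.
by rewrite [T k.+1 n.+1]/T big_ord_recr /= addSnnS /T /GRing.scale /=; ring.
Qed.

Let ge0_of_derive (g dg : R -> R) (s : R) : 0 <= s ->
  (forall t, 0 <= t <= s -> is_derive t 1 g (dg t)) ->
  (forall t, 0 <= t <= s -> 0 <= dg t) -> g 0 = 0 -> 0 <= g s.
Proof.
move=> s0 dgt dg0 g0.
have [t ts E] : exists2 t, t \in `[0, s] & g s - g 0 = dg t * (s - 0).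
  apply: MVT_segment => // [t|].
    by rewrite in_itv /= => /andP[? ?]; apply: dgt; rewrite !ltW.
  apply: continuous_in_subspaceT => t; rewrite inE /= in_itv /= => ts.
  apply/differentiable_continuous/derivable1_diffP.
  by have [] := dgt _ ts.
by move: E; rewrite g0 !subr0 => ->; rewrite mulr_ge0 // dg0.
Qed.

(** The remainder at index [k] and order [n.+1] has as derivative [c * s] times
the remainder at index [k.+1] and order [n]; integrating the bound for the
latter turns [P n] into [P n.+1]. *)
Let remainder n k (s : R) : (0 < n + k)%N -> 0 <= s <= r ->
  `|f k s - T k n s| <= B * P n s.
Proof.
elim: n k s => [|n IH] k s.
  rewrite add0n; case: k => // k _ sr.
  by rewrite /T big_ord0 subr0 P00 mulr1; exact: fB.
move=> _ /andP[s0 sr].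
have tr (t : R) : 0 <= t <= s -> 0 <= t <= r.
  by move=> /andP[-> ts]; exact: le_trans sr.
have main (e : R) : `|e| = 1 -> 0 <= B * P n.+1 s + e * (f k s - T k n.+1 s).
  move=> e1.
  pose g := (B \*: P n.+1) + e \*: (f k - T k n.+1).
  pose dg t := B * (c * t * P n t) + e * (c * t * f k.+1 t - c * t * T k.+1 n t).
  rewrite -[leRHS]/(g s); apply: (ge0_of_derive (dg := dg) s0).
  - move=> t /tr ts; have d1 := is_derive_P n t; have d2 := df k ts.
    have d3 := is_derive_T n k t.
    by apply: is_derive_eq.
  - move=> t ts; have /andP[t0 _] := ts.
    rewrite /dg (_ : _ + _ = c * t * (B * P n t + e * (f k.+1 t - T k.+1 n t))); last by ring.
    rewrite mulr_ge0 ?mulr_ge0 //.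
    have := IH k.+1 t _ (tr t ts); rewrite addnS => /(_ isT).
    rewrite -[X in X <= _ -> _]mul1r -e1 -normrM ler_norml => /andP[+ _].
    by rewrite -subr_ge0 opprK addrC.
  - have -> : g 0 = B * P n.+1 0 + e * (f k 0 - T k n.+1 0) by [].
    rewrite PS0 mulr0 add0r.
    rewrite /T big_ord_recl P00 /= addn0 mulr1 big1 ?addr0 ?subrr ?mulr0 // => j _.
    by rewrite PS0 mulr0.
rewrite ler_norml; apply/andP; split.
  by have := main 1 (normr1 _); rewrite mul1r => h; rewrite -subr_ge0 opprK addrC.
by have := main (-1) (normrN1 _); rewrite mulN1r subr_ge0.
Qed.

(** The derivative of [c * s ^+ 2 / 2] is [c * s], so in that variable each [f k]
has derivative [f k.+1]: this is the Taylor series of [f 0] at the origin, and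
the common bound [B] on the derivatives makes the remainder tend to zero. *)
Lemma derivation_chain_series :
  series (fun j => f j 0 * ((c * r ^+ 2 / 2) ^+ j / j`!%:R)) @ \oo --> f 0%N r.
Proof.
have P_cvg0 : B * P n r @[n --> \oo] --> B * 0.
  apply: cvgM; first exact: cvg_cst.
  rewrite (_ : (fun n => P n r) = exp_coeff (c * r ^+ 2 / 2)); last by apply/funext.
  exact: cvg_series_cvg_0 (is_cvg_series_exp_coeff _).
rewrite mulr0 in P_cvg0.
apply: cvg_zero; apply: norm_cvg0.
apply: (@squeeze_cvgr _ _ _ _ (cst 0) (fun n => B * P n r)) => //; last exact: cvg_cst.
near=> n; rewrite normr_ge0 /= distrC.
have := @remainder n 0%N r; rewrite addn0 => H.
rewrite /series /= big_mkord; apply: H; last by rewrite r0 lexx.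
by near: n; exact: nbhs_infty_gt.
Unshelve. all: by end_near. Qed.

End derivation_chain.

(** * Means of a panharmonic function *)

Section panharmonic_means.
Context {R : realType}.
Notation D := (@unit_disc R).
Notation K := [set z : R * R | z.1 ^+ 2 + z.2 ^+ 2 <= 1].
Variables (Omega : set (R * R)) (x : R * R) (rho : R).
Hypothesis oO : open Omega.
Hypothesis Orho : forall (s : R) z, `|s| < rho -> K z -> Omega (x + s *: z).
Variables (mu : R) (v : R * R -> R).
Hypothesis panv : panharmonic mu Omega v.
Let mD := @measurable_unit_disc R.

Let C1v : C1_on Omega v. Proof. by have [[]] := panv. Qed.
Let C1v1 : C1_on Omega (partial1 v). Proof. by have [[]] := panv. Qed.
Let C1v2 : C1_on Omega (partial2 v). Proof. by have [[]] := panv. Qed.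

(** Neither of these two means is divided by the total mass of its kernel. *)
Definition weighted_mean k (s : R) :=
  \int[leb2 R]_(z in D) (v (x + s *: z) * weight k z).

Definition log_mean (s : R) :=
  \int[leb2 R]_(z in D) (v (x + s *: z) * log_kernel z).

Let split_gradient (phi : R * R -> R) (s : R) : `|s| < rho ->
  (leb2 R).-integrable D (EFin \o (fun z => z.1 * phi z)) ->
  (leb2 R).-integrable D (EFin \o (fun z => z.2 * phi z)) ->
  \int[leb2 R]_(z in D)
     ((z.1 * partial1 v (x + s *: z) + z.2 * partial2 v (x + s *: z)) * phi z) =
  \int[leb2 R]_(z in D) (partial1 v (x + s *: z) * (z.1 * phi z)) +
  \int[leb2 R]_(z in D) (partial2 v (x + s *: z) * (z.2 * phi z)).
Proof.
move=> srho i1 i2; rewrite -RintegralD //.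
- by apply: eq_Rintegral => z _; ring.
- exact: integrable_dilateM (C1_continuous C1v1 oO) i1 srho.
- exact: integrable_dilateM (C1_continuous C1v2 oO) i2 srho.
Qed.

(** Integration by parts in both coordinates replaces the gradient of [v] against
[z * weight k] by its Laplacian against [weight k.+1]. *)
Lemma is_derive_weighted_mean k (s : R) : `|s| < rho ->
  is_derive s 1 (weighted_mean k) (mu ^+ 2 * s * weighted_mean k.+1 s).
Proof.
move=> srho.
apply: (is_derive_eq (is_derive_disc_integral oO Orho C1v (integrable_weight k) srho)).
rewrite split_gradient //; last 2 first.
- apply: integrable_disc_continuous => z _.
  by apply: cvgM; [exact: cvg_fst|exact: continuous_weight].
- apply: integrable_disc_continuous => z _.
  by apply: cvgM; [exact: cvg_snd|exact: continuous_weight].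
rewrite (weight_by_parts1 oO Orho k C1v1 srho) (weight_by_parts2 oO Orho k C1v2 srho).
have [_ _ c11 _] := C1v1; have [_ _ _ c22] := C1v2.
have iW := @integrable_weight R k.+1.
rewrite -mulrDr -RintegralD //; last 2 first.
- exact: integrable_dilateM c11 iW srho.
- exact: integrable_dilateM c22 iW srho.
rewrite (mulrC (mu ^+ 2)) -mulrA; congr (_ * _).
rewrite /weighted_mean -RintegralZl //; last first.
  exact: integrable_dilateM (C1_continuous C1v oO) iW srho.
apply: eq_Rintegral => z; rewrite inE => /ltW Kz.
have [_ lap] := panv; have := lap _ (Orho srho Kz) => /eqP.
by rewrite subr_eq0 /laplacian => /eqP h; rewrite -mulrDl h mulrA.
Qed.

(** The divergence of [z * v (x + s *: z) * log_kernel z] integrates to zero, and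
that of [z * log_kernel z] alone is [2 * log_kernel z - 1]. *)
Lemma log_mean_euler (s : R) : `|s| < rho ->
  s * (\int[leb2 R]_(z in D)
     ((z.1 * partial1 v (x + s *: z) + z.2 * partial2 v (x + s *: z)) * log_kernel z)) =
  weighted_mean 0 s - 2 * log_mean s.
Proof.
move=> srho; rewrite split_gradient //; last 2 first.
- exact: integrable_fst_log.
- exact: integrable_snd_log.
have h1 := log_by_parts1 oO Orho C1v srho.
have h2 := log_by_parts2 oO Orho C1v srho.
have cv := C1_continuous C1v oO.
have iL := integrable_dilateM Orho cv (@integrable_log_kernel R) srho.
have iW := integrable_dilateM Orho cv (@integrable_weight R 0) srho.
have i1 := integrable_dilateM Orho cv (@integrable_log1 R) srho.
have i2 := integrable_dilateM Orho cv (@integrable_log2 R) srho.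
have i2L : (leb2 R).-integrable D (EFin \o (fun z => 2 * (v (x + s *: z) * log_kernel z))).
  exact: (integrableZl mD 2 iL).
have : \int[leb2 R]_(z in D) (v (x + s *: z) * (log_kernel z - (1 - sqr_sine z))) +
       \int[leb2 R]_(z in D) (v (x + s *: z) * (log_kernel z - sqr_sine z)) =
    2 * log_mean s - weighted_mean 0 s.
  rewrite /log_mean /weighted_mean -RintegralZl // -RintegralD // -RintegralB //.
  by apply: eq_Rintegral => z _; rewrite /weight expr0 fact0; field.
by rewrite mulrDr; move: h1 h2; lra.
Qed.

(** The factor [t ^+ 2] absorbs the multiple of [log_mean] that [log_mean_euler]
leaves. *)
Lemma is_derive_sqr_log_mean (s : R) : `|s| < rho ->
  is_derive s 1 (fun t => t ^+ 2 * log_mean t) (s * weighted_mean 0 s).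
Proof.
move=> srho.
have dL := is_derive_disc_integral oO Orho C1v (@integrable_log_kernel R) srho.
have dq : is_derive s 1 (fun t : R => t ^+ 2) (s *+ 2).
  by apply: is_derive_eq; rewrite /GRing.scale /=; ring.
apply: (is_derive_eq (is_deriveM dq dL)).
rewrite /GRing.scale /= {1}expr2 -mulrA log_mean_euler //.
by rewrite -/(log_mean s); ring.
Qed.

Lemma weighted_mean0 k : weighted_mean k 0 = v x * moment k.
Proof.
rewrite /weighted_mean /moment -RintegralZl //; last exact: integrable_weight.
by apply: eq_Rintegral => z _; rewrite scale0r addr0.
Qed.

(** Shifting the weighted means by one makes room for the logarithmic mean, which
is thus handled by the same Taylor expansion. *)
Let chain k : R -> R :=
  if k is k'.+1 then weighted_mean k' else fun s => mu ^+ 2 * (s ^+ 2 * log_mean s).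

Let chain_term (r : R) j :
  chain j 0 * ((mu ^+ 2 * r ^+ 2 / 2) ^+ j / j`!%:R) =
  v x * (pi *+ 2) * ((mu * r / 2) ^+ j.*2 / j`!%:R ^+ 2 - (j == 0)%:R).
Proof.
case: j => [|j]; first by rewrite /= !expr0 fact0; field.
rewrite /chain weighted_mean0 momentE /= subr0.
rewrite -[j.+1.*2]muln2 mulnC exprM.
have -> : (mu * r / 2) ^+ 2 = (mu ^+ 2 * r ^+ 2 / 2) / 2 by field.
rewrite [in RHS]exprMn exprVn [in RHS](exprS 2).
have : (j.+1)`!%:R != 0 :> R by rewrite pnatr_eq0 -lt0n fact_gt0.
have : 2 ^+ j != 0 :> R by rewrite expf_neq0.
move: ((j.+1)`!%:R : R) (2 ^+ j : R) (_ ^+ j.+1 : R) => u w y w0 u0.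
by field; rewrite w0 u0.
Qed.

(** By [chain_term] the Taylor coefficients of the chain are those of the Bessel
function, without its constant term. *)
Lemma log_mean_bessel (r : R) : 0 < r < rho ->
  mu ^+ 2 * (r ^+ 2 * log_mean r) = v x * (pi *+ 2) * (besselI0 (mu * r) - 1).
Proof.
move=> /andP[r0 rrho].
have norm_r (s : R) : 0 <= s <= r -> `|s| <= r by move=> /andP[s0 sr]; rewrite ger0_norm.
have srho (s : R) : 0 <= s <= r -> `|s| < rho by move/norm_r => /le_lt_trans; apply.
have cv := C1_continuous C1v oO.
have [M M0 vM] := bounded_dilation Orho rrho cv.
have lim := @derivation_chain_series _ chain (mu ^+ 2) r (M * pi) (sqr_ge0 _) (ltW r0) _ _.
have {}lim : series (fun j => v x * (pi *+ 2) *
    ((mu * r / 2) ^+ j.*2 / j`!%:R ^+ 2 - (j == 0)%:R)) @ \oo --> chain 0 r.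
  rewrite (_ : (fun j => _) = (fun j =>
      chain j 0 * ((mu ^+ 2 * r ^+ 2 / 2) ^+ j / j`!%:R))); last first.
    by apply/funext => j; rewrite chain_term.
  apply: lim => [[|k] s sr|k s sr].
  - have dJ := is_derive_sqr_log_mean (srho _ sr).
    rewrite (_ : chain 0 = mu ^+ 2 \*: (fun t => t ^+ 2 * log_mean t)) //.
    by apply: is_derive_eq; rewrite /GRing.scale /= mulrA.
  - exact: is_derive_weighted_mean (srho _ sr).
  - apply: (disc_integral_le Orho cv (integrable_weight k) (srho _ sr)) => //.
    + by move=> z /ltW Kz; apply: vM => //; exact: norm_r.
    + by move=> z Dz; rewrite ger0_norm ?weight_ge0 // weight_le1.
pose t j : R := (mu * r / 2) ^+ j.*2 / j`!%:R ^+ 2.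
pose a j : R := v x * (pi *+ 2) * (t j - (j == 0)%:R).
rewrite -[X in series X]/a in lim.
have lim' : v x * (pi *+ 2) * (series t n - 1) @[n --> \oo] --> chain 0 r.
  rewrite -(cvg_shiftS (fun n => v x * (pi *+ 2) * (series t n - 1))).
  rewrite (_ : (fun n => _) = [sequence series a n.+1]_n) ?(cvg_shiftS (series a)) //.
  apply/funext => n; rewrite /series /= -mulr_sumr sumrB; congr (_ * (_ - _)).
  by rewrite big_nat_recl // big1 ?addr0.
rewrite -[LHS]/(chain 0 r).
(* If [v x = 0] the convergence of the Bessel series cannot be read off [lim'],
   but then both sides are zero. *)
have [vx0|vx0] := eqVneq (v x) 0.
  have lim0 : v x * (pi *+ 2) * (series t n - 1) @[n --> \oo] --> (0 : R).
    rewrite (_ : (fun n => _) = cst 0); first exact: cvg_cst.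
    by apply/funext => n; rewrite vx0 !mul0r.
  by rewrite vx0 !mul0r; exact: (cvg_unique (@norm_hausdorff _ _) lim' lim0).
have p0 : v x * (pi *+ 2) != 0.
  by rewrite mulf_neq0 // mulrn_eq0 /= gt_eqF // pi_gt0.
have t_cvg : series t @ \oo --> chain 0 r / (v x * (pi *+ 2)) + 1.
  rewrite (_ : series t = (fun n => (v x * (pi *+ 2) * (series t n - 1)) / (v x * (pi *+ 2)) + 1)).
    by apply: cvgD; [apply: cvgM; [exact: lim'|exact: cvg_cst]|exact: cvg_cst].
  by apply/funext => n; rewrite mulrAC divff // mul1r subrK.
have -> : besselI0 (mu * r) = chain 0 r / (v x * (pi *+ 2)) + 1 by exact: cvg_lim t_cvg.
by rewrite addrK mulrC divfK.
Qed.

End panharmonic_means.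

(** * Change of variables between discs *)

Section scaling.
Context {R : realType}.

Lemma enormZ (s : R) (z : R * R) : 0 <= s -> enorm (s *: z) = s * enorm z.
Proof.
move=> s0; rewrite /enorm /= /GRing.scale /= !exprMn -mulrDr sqrtrM ?sqr_ge0 //.
by rewrite sqrtr_sqr ger0_norm.
Qed.

Lemma unit_discE (z : R * R) : unit_disc z = (enorm z < 1).
Proof. by rewrite /unit_disc /enorm /= -[in RHS]sqrtr1 ltr_sqrt. Qed.

Lemma disc_scale (s : R) (y z : R * R) : 0 < s -> disc y s (y + s *: z) = unit_disc z.
Proof.
move=> s0; rewrite /disc /= addrAC subrr add0r enormZ ?ltW //.
by rewrite gtr_pMr // unit_discE.
Qed.

Lemma open_disc (y : R * R) (s : R) : open (disc y s).
Proof.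
rewrite (_ : disc y s = (fun z => enorm (z - y)) @^-1` `]-oo, s[%classic); last first.
  by apply/seteqP; split => z; rewrite /disc /= in_itv.
apply: open_comp => [z _|]; last exact: interval_open.
pose q (w : R * R) : R := w.1 ^+ 2 + w.2 ^+ 2.
apply: (@continuous_comp _ _ _ (fun w : R * R => q (w - y)) Num.sqrt); last first.
  exact: sqrt_continuous.
apply: (@continuous_comp _ _ _ (fun w : R * R => w - y) q); last first.
  exact: continuous_sqnorm.
by apply: cvgB; [exact: cvg_id|exact: cvg_cst].
Qed.

Lemma measurable_disc (y : R * R) (s : R) :
  measurable (disc y s : set (measurableTypeR R * measurableTypeR R)).
Proof. by apply: open_prod_measurable; exact: open_disc. Qed.

Notation D := (@unit_disc R).
Notation mu := (@lebesgue_measure R).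
Variable r : R.
Hypothesis r0 : 0 < r.

Let rn : {nonneg R} := NngNum (ltW r0).
Let rn2 : {nonneg R} := NngNum (ltW (exprn_gt0 2 r0)).

Let affine (a : R) (t : measurableTypeR R) : measurableTypeR R := a + r * t.

Let image_measure d d' (T : measurableType d) (T' : measurableType d')
    (m : {measure set T -> \bar R}) (f : T -> T')
    (mf : measurable_fun [set: T] f) : {measure set T' -> \bar R} :=
  measure_function_pushforward__canonical__measure_function_Measure m mf.

Let measurable_affine a : measurable_fun [set: measurableTypeR R] (affine a).
Proof.
apply: measurable_funD; first exact: measurable_cst.
by apply: measurable_funM; [exact: measurable_cst|exact: measurable_id].
Qed.

(** Both sides are measures in [A] that agree on half-open intervals. *)
Lemma lebesgue_measure_affine (a : R) (A : set (measurableTypeR R)) :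
  measurable A -> mu A = (r%:E * mu (affine a @^-1` A))%E.
Proof.
move=> mA.
have := @lebesgue_measure_unique R (mscale rn (image_measure mu (measurable_affine a))).
apply => // X [[p q] _ <-] /=.
rewrite /mscale /image_measure /= /pushforward.
have -> : affine a @^-1` `]p, q]%classic = `](p - a) / r, (q - a) / r]%classic.
  apply/seteqP; split => t; rewrite /affine /= !in_itv /= ltr_pdivrMr // ler_pdivlMr //
    ltrBlDl lerBrDl (mulrC t) //.
rewrite !lebesgue_measure_itv /= !lte_fin ltr_pM2r ?invr_gt0 // ltrD2r.
case: ifP => _; last by rewrite mule0.
rewrite -!EFinD -EFinM; congr EFin.
by field; rewrite gt_eqF.
Qed.

Variable x : R * R.
Let phi (z : measurableTypeR R * measurableTypeR R) : measurableTypeR R * measurableTypeR R :=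
  (affine x.1 z.1, affine x.2 z.2).

Let measurable_phi : measurable_fun setT phi.
Proof.
apply: measurable_fun_pair.
  by apply: measurableT_comp; [exact: measurable_affine|exact: measurable_fst].
by apply: measurableT_comp; [exact: measurable_affine|exact: measurable_snd].
Qed.

(** Both sides are measures in [A] that agree on rectangles. *)
Lemma leb2_affine (A : set (measurableTypeR R * measurableTypeR R)) :
  measurable A -> leb2 R A = ((r ^+ 2)%:E * leb2 R (phi @^-1` A))%E.
Proof.
move=> mA.
have := @product_measure_unique _ _ _ _ _ mu mu
  (mscale rn2 (image_measure (leb2 R) measurable_phi)).
apply => // B C mB mC.
rewrite /mscale /image_measure /= /pushforward.
transitivity ((r ^+ 2)%:E * leb2 R ((affine x.1 @^-1` B) `*` (affine x.2 @^-1` C)))%E => //.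
have mpre a X : measurable X -> measurable (affine a @^-1` X).
  by move=> mX; rewrite -[_ @^-1` _]setTI; exact: measurable_affine.
rewrite product_measure1E; [|exact: mpre|exact: mpre].
rewrite (lebesgue_measure_affine x.1 mB) (lebesgue_measure_affine x.2 mC).
by rewrite expr2 EFinM muleACA.
Qed.

Lemma ge0_integral_disc (f : R * R -> \bar R) :
  measurable_fun (disc x r : set (measurableTypeR R * measurableTypeR R)) f ->
  measurable (disc x r : set (measurableTypeR R * measurableTypeR R)) ->
  (forall y, disc x r y -> 0 <= f y)%E ->
  (\int[leb2 R]_(y in disc x r) f y =
   (r ^+ 2)%:E * \int[leb2 R]_(z in D) f (x + r *: z)%R)%E.
Proof.
move=> mf mdisc f0.
rewrite (@eq_measure_integral _ _ _ _
  (mscale rn2 (image_measure (leb2 R) measurable_phi))); last first.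
  by move=> A mA _; exact: leb2_affine.
transitivity ((r ^+ 2)%:E * \int[image_measure (leb2 R) measurable_phi]_(y in disc x r) f y)%E.
  exact: (ge0_integral_mscale (image_measure (leb2 R) measurable_phi) mdisc rn2 mf f0).
rewrite (ge0_integral_pushforward measurable_phi (leb2 R) mdisc mf); last first.
  by move=> y; rewrite inE; exact: f0.
have -> : phi @^-1` disc x r = D.
  apply/seteqP; split => -[a b] /=; rewrite -(disc_scale x _ r0) /disc /= => h //.
rewrite (_ : f \o phi = fun z : R * R => f (x + r *: z)) //.
Qed.

Lemma integral_disc_dilation (g : R * R -> R) :
  measurable_fun (disc x r : set (measurableTypeR R * measurableTypeR R)) g ->
  (leb2 R).-integrable D (EFin \o (fun z : R * R => g (x + r *: z))) ->
  (\int[leb2 R]_(y in disc x r) (g y)%:E =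
   (r ^+ 2)%:E * \int[leb2 R]_(z in D) (g (x + r *: z)%R)%:E)%E.
Proof.
move=> mg ig.
have mG : measurable_fun (disc x r : set (measurableTypeR R * measurableTypeR R)) (EFin \o g).
  exact/measurable_EFinP.
have mdisc := measurable_disc x r.
rewrite (integralE (leb2 R) (disc x r) (EFin \o g)).
rewrite (integralE (leb2 R) D (EFin \o (fun z : R * R => g (x + r *: z)))).
rewrite (ge0_integral_disc (measurable_funepos mG) mdisc) //.
rewrite (ge0_integral_disc (measurable_funeneg mG) mdisc) //.
have fin_r2 : ((r ^+ 2)%:E : \bar R) \is a fin_num by [].
rewrite (muleBr fin_r2 (integrable_add_def measurable_unit_disc ig)).
rewrite -[EFin \o (fun z : R * R => g (x + r *: z))]/((EFin \o g) \o (fun z : R * R => x + r *: z)).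
by rewrite [in RHS]funepos_comp [in RHS]funeneg_comp.
Qed.

End scaling.

(** * The logarithmic mean value formula *)

Lemma ln_ratio_dilation {R : realType} (r : R) (x z : R * R) : 0 < r ->
  ln (r / enorm (x - (x + r *: z))) = log_kernel z.
Proof.
move=> r0; rewrite opprD addrA subrr sub0r -scalerN enormZ ?ltW //.
rewrite invfM mulrA divff ?gt_eqF // mul1r /enorm /= !sqrrN /log_kernel.
(* At [z = 0] both sides vanish, because [0^-1 = 0] and [ln 0 = 0]. *)
have [q0|q0] := ltP 0 (z.1 ^+ 2 + z.2 ^+ 2); last first.
  by rewrite ler0_sqrtr // invr0 !ln0 // oppr0 mul0r.
have s0 : 0 < Num.sqrt (z.1 ^+ 2 + z.2 ^+ 2) by rewrite sqrtr_gt0.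
rewrite -{2}(sqr_sqrtr (ltW q0)) lnXn // lnV ?posrE //.
by field.
Qed.

(** Undoing the dilation reduces this to the measurability of [log_kernel]. *)
Lemma measurable_ln_ratio {R : realType} (r : R) (x : R * R) : 0 < r ->
  measurable_fun [set: measurableTypeR R * measurableTypeR R]
    (fun y : R * R => ln (r / enorm (x - y))).
Proof.
move=> r0.
pose psi (y : R * R) : R * R := (r^-1 * (y.1 - x.1), r^-1 * (y.2 - x.2)).
have psiK y : y = x + r *: psi y.
  case: y x @psi => [c d] [a b] /=.
  by congr pair; rewrite /= /GRing.scale /=; field; rewrite gt_eqF.
rewrite (_ : (fun y => _) = @log_kernel R \o psi); last first.
  by apply/funext => y /=; rewrite -(ln_ratio_dilation x _ r0) -psiK.
apply: measurableT_comp; first exact: measurable_log_kernel.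
apply: measurable_fun_pair.
  apply: continuous_on_measurable => [|y _]; first exact: openT.
  apply: cvgM; first exact: cvg_cst.
  by apply: cvgB; [exact: cvg_fst|exact: cvg_cst].
apply: continuous_on_measurable => [|y _]; first exact: openT.
apply: cvgM; first exact: cvg_cst.
by apply: cvgB; [exact: cvg_snd|exact: cvg_cst].
Qed.

Theorem theorem3 (R : realType) (mu : R) (mu_neq0 : mu != 0)
    (Omega : set (R * R)) (domOmega : planar_domain Omega)
    (v : R * R -> R) (panv : panharmonic mu Omega v)
    (x : R * R) (r : R) (admD : admissible_disc Omega x r) :
  ((a_coef (mu * r) * v x)%:E =
   ((pi * r ^+ 2)^-1)%:E *
     \int[@lebesgue_measure R \x @lebesgue_measure R]_(y in disc x r)
       (v y * ln (r / enorm (x - y)))%:E)%E.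
Proof.
have [_ oO _] := domOmega; have [r0 clO] := admD.
have [rho rrho Orho] := admissible_dilation oO admD.
have r_abs : `|r| < rho by rewrite gtr0_norm.
have [[C1v _ _] _] := panv; have cv := C1_continuous C1v oO.
have pullback z : v (x + r *: z) * ln (r / enorm (x - (x + r *: z))) =
    v (x + r *: z) * log_kernel z by rewrite ln_ratio_dilation.
have iL : (leb2 R).-integrable unit_disc
    (EFin \o (fun z => v (x + r *: z) * ln (r / enorm (x - (x + r *: z))))).
  rewrite (_ : (fun z => _) = (fun z => v (x + r *: z) * log_kernel z)); last first.
    by apply/funext => z; exact: pullback.
  exact: integrable_dilateM cv (@integrable_log_kernel R) r_abs.
have mg : measurable_fun (disc x r : set (measurableTypeR R * measurableTypeR R))
    (fun y => v y * ln (r / enorm (x - y))).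
  apply: measurable_funM.
    apply: continuous_on_measurable => [|y yD]; first exact: open_disc.
    by apply: cv; exact/clO/subset_closure.
  by apply: measurable_funS (measurable_ln_ratio x r0) => //.
rewrite (integral_disc_dilation r0 mg iL).
have -> : (\int[leb2 R]_(z in unit_disc)
    (v (x + r *: z)%R * ln (r / enorm (x - (x + r *: z))))%:E)%E = (log_mean x v r)%:E.
  rewrite /log_mean /Rintegral fineK; last first.
    apply: (integrable_fin_num measurable_unit_disc).
    exact: integrable_dilateM cv (@integrable_log_kernel R) r_abs.
  by apply: eq_integral => z _; rewrite pullback.
rewrite -!EFinM; congr EFin.
have := log_mean_bessel oO Orho panv (r := r); rewrite r0 rrho => /(_ isT) H.
apply: (@mulfI _ (mu ^+ 2)); first by rewrite expf_neq0.
rewrite [RHS]mulrCA H /a_coef.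
move: (pi : R) (pi_gt0 R) => p p0.
by field; rewrite mu_neq0 !gt_eqF.
Qed.
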